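(* Let $K\ge1$, let $f(z)=h(z)+\overline{g(z)}=\sum_{n=0}^\infty a_nz^n+\overline{\sum_{n=1}^\infty b_nz^n}$ be a sense-preserving $K$-quasiconformal harmonic mapping in $\mathbb{D}$, where $h$ is bounded in $\mathbb{D}$, and let $p\in(0,2]$. Let $a,b,c$ be positive real numbers such that $(a+n)(b+n)r-(c+n)(1+n)\le 0$ for all integers $n\ge0$ and $r\in[0,1]$, and let $\gamma_n=\frac{(a)_n(b)_n}{(c)_n(1)_n}$. Then $$|a_0|^p+\sum_{n=1}^\infty\gamma_n|a_n|r^n+\sum_{n=1}^\infty\gamma_n|b_n|r^n\le\|h\|_\infty\quad\text{for } r\le r_0,$$ where $r_0\in(0,1)$ is the minimal positive root of the equation $F(a,b,c,r)-1=\dfrac{p(K+1)}{4K}$. The number $r_0$ cannot be improved.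
   Context: $\mathbb{D}=\{z\in\mathbb{C}:|z|<1\}$ and $\|h\|_\infty=\sup_{z\in\mathbb{D}}|h(z)|$. A harmonic mapping $f=h+\overline{g}$ ($h,g$ analytic in $\mathbb{D}$) is locally univalent and sense-preserving iff $|h'|^2-|g'|^2>0$ in $\mathbb{D}$; such an $f$ is called $K$-quasiconformal ($K\ge1$) if $|g'(z)/h'(z)|\le k$ for all $z\in\mathbb{D}$, where $k=(K-1)/(K+1)\in[0,1)$. The Pochhammer symbol is $(a)_0=1$, $(a)_n=a(a+1)\cdots(a+n-1)$ for $n>0$. The Gaussian hypergeometric function is $F(a,b,c,z)={}_2F_1(a,b;c;z)=\sum_{n=0}^\infty\gamma_nz^n$ with $\gamma_n=\frac{(a)_n(b)_n}{(c)_n(1)_n}$, $z\in\mathbb{D}$. The parameters $a,b,c$ are unrelated to the coefficients $a_n,b_n$. ''The number $r_0$ cannot be improved'' means: for no $r_0'>r_0$ does the inequality hold for all such $f$ and all $r\le r_0'$.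
   Formalization: The formal theorem also assumes ‖h‖_∞^p ≤ ‖h‖_∞ (automatic if p=1 or ‖h‖_∞=1): otherwise the inequality fails, e.g. p=2, g=0, h=2−e+ez with small e>0, at r=0. That a root r_0 in (0,1) exists is assumed, since for some a,b,c there is none. *)

(* Defs.v *)
From Stdlib Require Import Reals.
From Coquelicot Require Import Coquelicot.
Open Scope R_scope.

Definition in_disc (z : C) : Prop := Cmod z < 1.

Definition holomorphic_disc (h : C -> C) : Prop :=
  forall z : C, in_disc z ->
    @ex_derive C_AbsRing C_NormedModule h z.

Definition power_series_disc (a : nat -> C) (h : C -> C) : Prop :=
  forall z : C, in_disc z ->
    @is_pseries C_AbsRing C_NormedModule a z (h z).

(* f = h + conj g, h(z) = sum_{n>=0} an z^n, g(z) = sum_{n>=1} bn z^n: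
   the sequence bn is indexed from 0, with the constant term required to be 0. *)
Definition harmonic_mapping (f h g : C -> C) (an bn : nat -> C) : Prop :=
  holomorphic_disc h /\ holomorphic_disc g /\
  power_series_disc an h /\ power_series_disc bn g /\ bn O = RtoC 0 /\
  (forall z : C, in_disc z -> f z = (h z + Cconj (g z))%C).

(* |h'|^2 - |g'|^2 is the Jacobian of h + conj g. *)
Definition sense_preserving (h g : C -> C) : Prop :=
  forall z : C, in_disc z ->
    0 < Cmod (C_derive h z) ^ 2 - Cmod (C_derive g z) ^ 2.

(* Only used together with sense_preserving, so that h' has no zero. *)
Definition quasiconformal (K : R) (h g : C -> C) : Prop :=
  forall z : C, in_disc z ->
    Cmod (C_derive g z / C_derive h z)%C <= (K - 1) / (K + 1).

Definition bounded_disc (h : C -> C) : Prop :=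
  exists M : R, forall z : C, in_disc z -> Cmod (h z) <= M.

(* [real] sends an infinite supremum to 0; only used for bounded h. *)
Definition sup_norm (h : C -> C) : R :=
  real (Lub_Rbar (fun x : R => exists z : C, in_disc z /\ x = Cmod (h z))).

(* x^p for x >= 0 and p > 0.  The case x = 0 is separate because
   Rpower 0 p = exp (p * ln 0) = 1 with the library convention ln 0 = 0. *)
Definition rpow (x p : R) : R := if Rle_dec x 0 then 0 else Rpower x p.

Fixpoint pochhammer (a : R) (n : nat) : R :=
  match n with
  | O => 1
  | S m => pochhammer a m * (a + INR m)
  end.

Definition hyp_coef (a b c : R) (n : nat) : R :=
  (pochhammer a n * pochhammer b n) / (pochhammer c n * pochhammer 1 n).

Definition hyp2F1 (a b c x : R) : R := PSeries (hyp_coef a b c) x.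

Definition minimal_positive_root (G : R -> R) (y r0 : R) : Prop :=
  0 < r0 < 1 /\ G r0 = y /\ (forall r : R, 0 < r < r0 -> G r <> y).

(* The last clause reads ||h||^p <= ||h||.  It holds for every h when p = 1, and
   for every p when ||h|| = 1.  It cannot be dropped, because the two sides of
   the Bohr inequality below scale differently: if M^p > M, the inequality fails
   even at r = 0 for h(z) = M - e + e z, g = 0, e > 0 small, where ||h|| = M. *)
Definition admissible (K p : R) (f h g : C -> C) (an bn : nat -> C) : Prop :=
  harmonic_mapping f h g an bn /\
  sense_preserving h g /\
  quasiconformal K h g /\
  bounded_disc h /\
  rpow (sup_norm h) p <= sup_norm h.

(* Convergence is part of the claim, since [Series] is total. *)
Definition bohr_inequality
    (gam : nat -> R) (p : R) (h : C -> C) (an bn : nat -> C) (r : R) : Prop :=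
  let u n := gam (S n) * Cmod (an (S n)) * r ^ S n in
  let v n := gam (S n) * Cmod (bn (S n)) * r ^ S n in
  ex_series u /\ ex_series v /\
  rpow (Cmod (an O)) p + Series u + Series v <= sup_norm h.

(* Main.v *)
Require Import Defs.
From Stdlib Require Import Reals Lra Lia.
From Coquelicot Require Import Coquelicot.
Open Scope R_scope.

(* Put [A = M - |a_0|^2 / M] with [M] the supremum of [|h|].  Bessel's inequality for
   [(c_0 + c_1 z^n) h(z)], with a suitable choice of [c_0, c_1], gives [|a_n| <= A].
   Since [omega = g' / h'] is bounded by [k = (K-1)/(K+1)] and the first [N]
   coefficients of [g' = omega h'] depend only on those of [h'], Bessel's inequality for
   [omega] times a Taylor polynomial of [h'] gives
   [sum_{n <= N} n^2 |b_n|^2 <= k^2 sum_{n <= N} n^2 |a_n|^2] for every [N].  The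
   hypothesis on [a, b, c] says that [gamma_n] is nonincreasing, so Abel summation with
   the weights [gamma_n r^n / n^2] and the Cauchy-Schwarz inequality give
   [sum gamma_n |b_n| r^n <= k A (F(r) - 1)].  As [1 + k = 2K/(K+1)], the claim reduces to
   [x^p + (p/2) (1 - x^2) <= 1] for [x = |a_0| / M].
   Sharpness: [h(z) = (al - z) / (1 - al z)], [g = k (h - al)], [al -> 1].

   Fourier analysis on circles is done with averages over roots of unity, whose limits
   replace integrals; Cauchy's theorem takes the form "the averages of [f] tend to
   [f 0]". *)

(** * Finite sums and averages over roots of unity *)

(** The coefficients [bn] are not bounded one at a time: [|g'| <= k |h'|] is used only through sums
    of squares. It controls them for every truncation, which is what lets nonincreasing weights in.
    The single number [A] serves both series: it bounds each [|a_n|] and, in the weighted mean,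
    [k A] bounds [|b_n|]. The left side is therefore at most [|a_0|^p + (1 + k) A (F(r) - 1)], and
    the right side of the root equation is exactly [p / 2] divided by [1 + k]. The chain is
    asymptotically sharp. For the extremal maps [|b_n| = k |a_n|] and [|a_n| = A al^(n-1)], nearly
    constant in [n] for [al] close to 1, so Cauchy-Schwarz loses little; and [1 - al^p] is about
    [p (1 - al)] while [1 - al^2] is about [2 (1 - al)], whence the factor [p / 2]. For a fixed
    number of roots of unity the averages of a power series suffer from aliasing (all indices in a
    residue class are mixed); only the limit isolates a single coefficient. *)

Fixpoint csum (u : nat -> C) (n : nat) : C :=
  match n with O => RtoC 0 | S m => (csum u m + u m)%C end.

Fixpoint rsum (u : nat -> R) (n : nat) : R :=
  match n with O => 0 | S m => rsum u m + u m end.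

Lemma csum_ext (u v : nat -> C) (n : nat) :
  (forall i, (i < n)%nat -> u i = v i) -> csum u n = csum v n.
Proof.
  induction n as [|n IH]; intros E; simpl; [reflexivity|].
  rewrite IH by (intros; apply E; lia). now rewrite E by lia.
Qed.

Lemma csum_plus (u v : nat -> C) (n : nat) :
  csum (fun i => u i + v i)%C n = (csum u n + csum v n)%C.
Proof. induction n as [|n IH]; simpl; [|rewrite IH]; ring. Qed.

Lemma csum_scal (c : C) (u : nat -> C) (n : nat) :
  csum (fun i => c * u i)%C n = (c * csum u n)%C.
Proof. induction n as [|n IH]; simpl; [|rewrite IH]; ring. Qed.

Lemma csum_minus (u v : nat -> C) (n : nat) :
  csum (fun i => u i - v i)%C n = (csum u n - csum v n)%C.
Proof. induction n as [|n IH]; simpl; [|rewrite IH]; ring. Qed.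

Lemma csum_const (c : C) (n : nat) : csum (fun _ => c) n = (INR n * c)%C.
Proof.
  induction n as [|n IH]; [simpl; ring|].
  rewrite S_INR, RtoC_plus. simpl csum. rewrite IH. ring.
Qed.

Lemma csum_conj (u : nat -> C) (n : nat) :
  csum (fun i => Cconj (u i)) n = Cconj (csum u n).
Proof.
  induction n as [|n IH]; simpl.
  - unfold Cconj, RtoC; simpl. f_equal; ring.
  - now rewrite IH, Cplus_conj.
Qed.

Lemma csum_telescope (u : nat -> C) (n : nat) :
  csum (fun i => u (S i) - u i)%C n = (u n - u 0%nat)%C.
Proof. induction n as [|n IH]; simpl; [|rewrite IH]; ring. Qed.

Lemma Cmod_csum_le (u : nat -> C) (v : nat -> R) (n : nat) :
  (forall i, (i < n)%nat -> Cmod (u i) <= v i) -> Cmod (csum u n) <= rsum v n.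
Proof.
  induction n as [|n IH]; intros E; simpl.
  - rewrite Cmod_0; lra.
  - eapply Rle_trans; [apply Cmod_triangle|].
    apply Rplus_le_compat; [apply IH; intros; apply E; lia | apply E; lia].
Qed.

Lemma rsum_le (u v : nat -> R) (n : nat) :
  (forall i, (i < n)%nat -> u i <= v i) -> rsum u n <= rsum v n.
Proof.
  induction n as [|n IH]; intros E; simpl; [lra|].
  apply Rplus_le_compat; [apply IH; intros; apply E; lia | apply E; lia].
Qed.

Lemma rsum_ext (u v : nat -> R) (n : nat) :
  (forall i, (i < n)%nat -> u i = v i) -> rsum u n = rsum v n.
Proof.
  induction n as [|n IH]; intros E; simpl; [reflexivity|].
  rewrite IH by (intros; apply E; lia). now rewrite E by lia.
Qed.

Lemma rsum_const (c : R) (n : nat) : rsum (fun _ => c) n = INR n * c.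
Proof. induction n as [|n IH]; [simpl; ring|]. rewrite S_INR. simpl rsum. rewrite IH. ring. Qed.

Lemma rsum_scal (c : R) (u : nat -> R) (n : nat) :
  rsum (fun i => c * u i) n = c * rsum u n.
Proof. induction n as [|n IH]; simpl; [|rewrite IH]; ring. Qed.

Lemma rsum_plus (u v : nat -> R) (n : nat) :
  rsum (fun i => u i + v i) n = rsum u n + rsum v n.
Proof. induction n as [|n IH]; simpl; [|rewrite IH]; ring. Qed.

Lemma rsum_nonneg (u : nat -> R) (n : nat) :
  (forall i, (i < n)%nat -> 0 <= u i) -> 0 <= rsum u n.
Proof.
  intros E. apply Rle_trans with (rsum (fun _ => 0) n).
  - rewrite rsum_const; lra.
  - now apply rsum_le.
Qed.

Lemma Cmod_csum_const (u : nat -> C) (b : R) (n : nat) :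
  (forall i, (i < n)%nat -> Cmod (u i) <= b) -> Cmod (csum u n) <= INR n * b.
Proof. intros E. rewrite <- rsum_const. now apply Cmod_csum_le. Qed.

Lemma Cmod_minus_le (x y : C) : Cmod (x - y) <= Cmod x + Cmod y.
Proof. unfold Cminus. rewrite <- (Cmod_opp y). apply Cmod_triangle. Qed.

Lemma Cmod_minus_sym (x y : C) : Cmod (x - y) = Cmod (y - x).
Proof. rewrite <- Cmod_opp. f_equal. ring. Qed.

Lemma Cmod_RtoC_pos (x : R) : 0 <= x -> Cmod x = x.
Proof. intros. rewrite Cmod_R. now apply Rabs_right, Rle_ge. Qed.

(** * Roots of unity *)

Definition zeta (n : nat) : C := (cos (2 * PI / INR n), sin (2 * PI / INR n)).

Lemma Cpow_cis (x : R) (n : nat) :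
  (((cos x, sin x) : C) ^ n)%C = (cos (INR n * x), sin (INR n * x)).
Proof.
  induction n as [|n IH].
  - simpl. rewrite Rmult_0_l, cos_0, sin_0. reflexivity.
  - rewrite Cpow_S, IH, S_INR.
    replace ((INR n + 1) * x) with (x + INR n * x) by ring.
    rewrite cos_plus, sin_plus. unfold Cmult; simpl. f_equal; ring.
Qed.

Lemma zeta_pow (n : nat) : (0 < n)%nat -> (zeta n ^ n)%C = 1.
Proof.
  intros Hn. unfold zeta. rewrite Cpow_cis.
  replace (INR n * (2 * PI / INR n)) with (2 * PI)
    by (field; apply not_0_INR; lia).
  now rewrite cos_2PI, sin_2PI.
Qed.

Lemma Cmod_zeta (n : nat) : Cmod (zeta n) = 1.
Proof.
  unfold zeta, Cmod; simpl.
  apply eq_trans with (sqrt 1); [f_equal|apply sqrt_1].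
  generalize (sin2_cos2 (2 * PI / INR n)). unfold Rsqr. lra.
Qed.

Lemma Cmod_zeta_pow (n j : nat) : Cmod (zeta n ^ j) = 1.
Proof. rewrite Cmod_pow, Cmod_zeta. apply pow1. Qed.

(** [smooth_angular] divides by [zeta n - 1]; this is where the restriction to [n >= 2] in
    [mean_tends] comes from. *)
Lemma zeta_neq_1 (n : nat) : (2 <= n)%nat -> zeta n <> 1.
Proof.
  intros Hn E.
  assert (H2 : 2 <= INR n) by (apply (le_INR 2); lia).
  assert (E1 : cos (2 * PI / INR n) = 1) by (apply (f_equal fst) in E; exact E).
  assert (P := PI_RGT_0).
  replace (2 * PI / INR n) with (2 * (PI / INR n)) in E1 by (field; lra).
  rewrite cos_2a_sin in E1.
  assert (0 < sin (PI / INR n)).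
  { apply sin_gt_0.
    - apply Rdiv_lt_0_compat; lra.
    - apply Rmult_lt_reg_r with (INR n); [lra|]. unfold Rdiv.
      rewrite Rmult_assoc, Rinv_l by lra. apply Rmult_lt_compat_l; lra. }
  nra.
Qed.

Lemma sin_sqr_le (x : R) : sin x * sin x <= x * x.
Proof.
  assert (P : forall y, 0 <= y -> sin y * sin y <= y * y).
  { intros y Hy. destruct (Rle_dec y 1).
    - assert (0 <= sin y) by (apply sin_ge_0; generalize PI_RGT_0 PI2_3_2; lra).
      assert (sin y <= y).
      { destruct (Req_dec y 0) as [->|]; [rewrite sin_0; lra|].
        left; apply sin_lt_x; lra. }
      nra.
    - generalize (SIN_bound y). nra. }
  destruct (Rle_dec 0 x); [now apply P|].
  replace (sin x * sin x) with (sin (-x) * sin (-x)) by (rewrite sin_neg; ring).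
  replace (x * x) with (-x * -x) by ring. apply P; lra.
Qed.

(** The chord is at most the arc: with [x = PI / n] the squared chord is [4 sin(x)^2]. *)
Lemma Cmod_zeta_minus_1 (n : nat) : (0 < n)%nat -> Cmod (zeta n - 1) <= 2 * PI / INR n.
Proof.
  intros Hn. assert (H2 : 0 < INR n) by (apply lt_0_INR; lia).
  assert (P := PI_RGT_0).
  assert (0 < PI / INR n) by (apply Rdiv_lt_0_compat; lra).
  unfold zeta. replace (2 * PI / INR n) with (2 * (PI / INR n)) by (field; lra).
  set (x := PI / INR n) in *.
  apply Rle_trans with (sqrt (Rsqr (2 * x))); [|rewrite sqrt_Rsqr; lra].
  unfold Cmod; simpl. apply sqrt_le_1_alt.
  rewrite cos_2a_sin, sin_2a. unfold Rsqr.
  generalize (sin2_cos2 x) (sin_sqr_le x). unfold Rsqr. nra.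
Qed.

Definition circle_mean (n : nat) (rho : R) (F : C -> C) : C :=
  (csum (fun j => F (rho * zeta n ^ j)%C) n / INR n)%C.

(* The rate [1/n] makes these limits closed under linear combinations without any
   epsilon management. *)
Definition mean_tends (rho : R) (F : C -> C) (l : C) : Prop :=
  exists B : R, forall n : nat, (2 <= n)%nat ->
    Cmod (circle_mean n rho F - l) <= B / INR n.

Lemma INR_neq_0_C (n : nat) : (0 < n)%nat -> RtoC (INR n) <> 0.
Proof. intros Hn E. apply RtoC_inj in E. apply (not_0_INR n); lia || exact E. Qed.

Lemma Cmod_circle (n j : nat) (rho : R) : 0 <= rho -> Cmod (rho * zeta n ^ j) = rho.
Proof. intros. rewrite Cmod_mult, Cmod_zeta_pow, Cmod_RtoC_pos by easy. ring. Qed.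

Lemma mean_tends_ext (rho : R) (F G : C -> C) (l : C) :
  0 <= rho -> (forall z, Cmod z = rho -> F z = G z) ->
  mean_tends rho F l -> mean_tends rho G l.
Proof.
  intros Hr E [B HB]. exists B. intros n Hn. specialize (HB n Hn).
  unfold circle_mean in *. erewrite csum_ext; [exact HB|].
  intros i _. symmetry. apply E. now apply Cmod_circle.
Qed.

Lemma mean_tends_plus (rho : R) (F G : C -> C) (l m : C) :
  mean_tends rho F l -> mean_tends rho G m ->
  mean_tends rho (fun z => F z + G z)%C (l + m)%C.
Proof.
  intros [B HB] [D HD]. exists (B + D). intros n Hn.
  specialize (HB n Hn). specialize (HD n Hn). unfold circle_mean in *.
  rewrite csum_plus.
  replace ((_ + _) / _ - (l + m))%C with
    ((csum (fun j => F (rho * zeta n ^ j)%C) n / INR n - l) +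
     (csum (fun j => G (rho * zeta n ^ j)%C) n / INR n - m))%C
    by (field; apply INR_neq_0_C; lia).
  eapply Rle_trans; [apply Cmod_triangle|].
  replace ((B + D) / INR n) with (B / INR n + D / INR n)
    by (field; apply not_0_INR; lia).
  lra.
Qed.

Lemma mean_tends_scal (rho : R) (c : C) (F : C -> C) (l : C) :
  mean_tends rho F l -> mean_tends rho (fun z => c * F z)%C (c * l)%C.
Proof.
  intros [B HB]. exists (Cmod c * B). intros n Hn.
  specialize (HB n Hn). unfold circle_mean in *. rewrite csum_scal.
  replace (c * _ / _ - c * l)%C with
    (c * (csum (fun j => F (rho * zeta n ^ j)%C) n / INR n - l))%C
    by (field; apply INR_neq_0_C; lia).
  rewrite Cmod_mult. unfold Rdiv. rewrite Rmult_assoc.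
  apply Rmult_le_compat_l; [apply Cmod_ge_0|exact HB].
Qed.

Lemma mean_tends_minus (rho : R) (F G : C -> C) (l m : C) :
  0 <= rho -> mean_tends rho F l -> mean_tends rho G m ->
  mean_tends rho (fun z => F z - G z)%C (l - m)%C.
Proof.
  intros Hr HF HG.
  replace (l - m)%C with (l + (-(1)) * m)%C by ring.
  apply mean_tends_ext with (fun z => F z + (-(1)) * G z)%C; [easy|intros; ring|].
  apply mean_tends_plus; [easy|]. now apply mean_tends_scal.
Qed.

Lemma mean_tends_conj (rho : R) (F : C -> C) (l : C) :
  mean_tends rho F l -> mean_tends rho (fun z => Cconj (F z)) (Cconj l).
Proof.
  intros [B HB]. exists B. intros n Hn. specialize (HB n Hn).
  unfold circle_mean in *. rewrite csum_conj.
  replace (_ - _)%C with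
    (Cconj (csum (fun j => F (rho * zeta n ^ j)%C) n / INR n - l)).
  - now rewrite Cmod_conj.
  - rewrite Cminus_conj, Cdiv_conj by (apply INR_neq_0_C; lia). f_equal. f_equal.
    unfold Cconj, RtoC; simpl. f_equal. ring.
Qed.

Lemma csum_Re (u : nat -> C) (n : nat) : Re (csum u n) = rsum (fun i => Re (u i)) n.
Proof. induction n as [|n IH]; simpl; [reflexivity|]. now rewrite <- IH. Qed.

(** The one place where a limit of averages is put to use. All averages have nonnegative real part,
    so [- Re l <= B / n], which fails for [n] beyond [B / (- Re l)] if [Re l] is negative. *)
Lemma mean_tends_Re_nonneg (rho : R) (F : C -> C) (l : C) :
  0 <= rho -> (forall z, Cmod z = rho -> 0 <= Re (F z)) ->
  mean_tends rho F l -> 0 <= Re l.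
Proof.
  intros Hr HF [B HB].
  destruct (Rle_dec 0 (Re l)) as [|Hneg]; [easy|exfalso].
  assert (Hd : 0 < - Re l) by lra.
  destruct (INR_unbounded (Rmax 2 (B / (- Re l)))) as [n Hn].
  assert (Hn1 := Rle_lt_trans _ _ _ (Rmax_l _ _) Hn).
  assert (Hn2 := Rle_lt_trans _ _ _ (Rmax_r _ _) Hn).
  assert (H2n : (2 <= n)%nat) by (apply INR_le; simpl; lra).
  specialize (HB n H2n).
  assert (HB' : - Re l <= B / INR n).
  { eapply Rle_trans; [|exact HB]. eapply Rle_trans; [|apply re_le_Cmod].
    eapply Rle_trans; [|apply Rle_abs].
    unfold circle_mean.
    replace (Re (_ - _)%C) with (/ INR n * Re (csum (fun j => F (rho * zeta n ^ j)%C) n) - Re l).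
    - rewrite csum_Re.
      assert (0 <= / INR n) by (left; apply Rinv_0_lt_compat; lra).
      match goal with |- _ <= ?x - _ => assert (0 <= x); [|lra] end.
      apply Rmult_le_pos; [easy|].
      apply rsum_nonneg. intros. apply HF. now apply Cmod_circle.
    - unfold Cdiv. rewrite <- RtoC_inv by lra. unfold Re, Cminus, Cplus, Cmult, Copp; simpl. ring. }
  assert (B < INR n * - Re l).
  { apply Rmult_lt_compat_r with (r := - Re l) in Hn2; [|lra].
    unfold Rdiv in Hn2. rewrite Rmult_assoc, Rinv_l in Hn2; lra. }
  apply Rmult_le_compat_r with (r := INR n) in HB'; [|lra].
  unfold Rdiv in HB'. rewrite Rmult_assoc, Rinv_l in HB' by lra. lra.
Qed.

(** * Cauchy's theorem for circle averages *)

(* Differentiability with a uniform quadratic remainder: all that the grid proof of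
   Cauchy's theorem uses, and stable under products and inverses. *)
Definition smooth (rho : R) (f f' : C -> C) : Prop :=
  exists B : R, forall z w : C, Cmod z <= rho -> Cmod w <= rho ->
    Cmod (f z) <= B /\ Cmod (f' z) <= B /\
    Cmod (f w - f z - f' z * (w - z)) <= B * Cmod (w - z) ^ 2.

(** The increments of [f] around the circle add up to 0, and their linear parts to [r (zeta - 1)]
    times the sum in question. With [d = |zeta - 1|] the [n] remainders total at most [n B (r d)^2];
    dividing by [r d] leaves [n d B r], and [n d <= 2 PI]. *)
Lemma smooth_angular (B rho r : R) (f f' : C -> C) (n : nat) :
  (2 <= n)%nat -> 0 < r <= rho -> 0 <= B ->
  (forall z w : C, Cmod z <= rho -> Cmod w <= rho ->
    Cmod (f w - f z - f' z * (w - z)) <= B * Cmod (w - z) ^ 2) ->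
  Cmod (csum (fun j => f' (r * zeta n ^ j) * zeta n ^ j)%C n) <= 2 * PI * B * rho.
Proof.
  intros Hn Hr HB Hf.
  assert (Hn0 : 0 < INR n) by (apply lt_0_INR; lia).
  assert (Hc : forall j, Cmod (r * zeta n ^ j) = r) by (intros; apply Cmod_circle; lra).
  set (T := csum _ n).
  assert (E : csum (fun j => f (r * zeta n ^ S j) - f (r * zeta n ^ j)
     - f' (r * zeta n ^ j) * (r * zeta n ^ S j - r * zeta n ^ j))%C n
     = (- (r * (zeta n - 1)) * T)%C).
  { rewrite csum_minus, (csum_telescope (fun j => f (r * zeta n ^ j)%C)).
    rewrite zeta_pow by lia. change (zeta n ^ 0)%C with (RtoC 1). unfold T.
    rewrite <- csum_scal.
    rewrite (csum_ext _ (fun i => (r * (zeta n - 1)) * (f' (r * zeta n ^ i) * zeta n ^ i))%C).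
    - rewrite csum_scal, csum_scal. ring.
    - intros i _. rewrite Cpow_S. ring. }
  set (d := Cmod (zeta n - 1)).
  assert (Hd : 0 < d).
  { apply Cmod_gt_0. intros E0. apply (zeta_neq_1 n Hn).
    rewrite <- (Cplus_0_l 1), <- E0. ring. }
  assert (Hd2 : d <= 2 * PI / INR n) by (apply Cmod_zeta_minus_1; lia).
  assert (HS : r * d * Cmod T <= INR n * (B * (r * d) ^ 2)).
  { replace (r * d * Cmod T) with (Cmod (- (r * (zeta n - 1)) * T)).
    - rewrite <- E. apply Cmod_csum_const. intros j _.
      eapply Rle_trans; [apply Hf; rewrite Hc; lra|].
      replace (r * zeta n ^ S j - r * zeta n ^ j)%C
        with (r * zeta n ^ j * (zeta n - 1))%C by (rewrite Cpow_S; ring).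
      rewrite Cmod_mult, Hc. fold d. lra.
    - rewrite Cmod_mult, Cmod_opp, Cmod_mult, Cmod_RtoC_pos by lra. fold d. ring. }
  assert (Hrd : 0 < r * d) by nra.
  assert (HS' : Cmod T <= INR n * B * r * d).
  { apply Rmult_le_reg_l with (r * d); [easy|]. eapply Rle_trans; [exact HS|]. right; ring. }
  eapply Rle_trans; [exact HS'|].
  assert (INR n * d <= 2 * PI).
  { apply Rmult_le_compat_l with (r := INR n) in Hd2; [|lra].
    replace (INR n * (2 * PI / INR n)) with (2 * PI) in Hd2 by (field; lra). exact Hd2. }
  replace (INR n * B * r * d) with ((INR n * d) * (B * r)) by ring.
  replace (2 * PI * B * rho) with ((2 * PI) * (B * rho)) by ring.
  apply Rmult_le_compat; try nra.
Qed.

(* Cauchy's theorem for circle means.  On the polar grid [i rho / n * zeta ^ j] with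
   [i, j <= n], passing from one circle to the next changes the sum over [j] by
   [rho / n * sum_j f' zeta^j + O(1/n)], and that sum is bounded because the increments
   of [f] along a whole circle cancel. *)
Lemma cauchy_mean (rho : R) (f f' : C -> C) :
  0 < rho -> smooth rho f f' -> mean_tends rho f (f 0).
Proof.
  intros Hrho [B Hf].
  assert (Z0 : Cmod 0 <= rho) by (rewrite Cmod_0; lra).
  assert (HB : 0 <= B).
  { eapply Rle_trans; [apply Cmod_ge_0|apply (proj1 (Hf 0 0 Z0 Z0))]. }
  assert (P := PI_RGT_0).
  (* [D / n] bounds the change of the sum [m] between consecutive circles: [s] times the bound of
     [smooth_angular] plus [n] remainders [B s^2], where [s = rho / n]. [A] bounds the first change,
     from the centre. As [m] is a sum and not yet an average, the bound [A + D] on the total change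
     becomes the rate [(A + D) / n]. *)
  set (D := (2 * PI + 1) * B * rho ^ 2).
  set (A := B * rho + B * rho ^ 2).
  exists (A + D). intros n Hn.
  assert (Hn0 : 0 < INR n) by (apply lt_0_INR; lia).
  assert (Hn2 : 1 <= INR n) by (apply (le_INR 1); lia).
  set (s := rho / INR n).
  assert (Hs : 0 < s) by (apply Rdiv_lt_0_compat; lra).
  assert (Hsn : INR n * s = rho) by (unfold s; field; lra).
  set (m := fun l : nat => csum (fun j => f (RtoC (INR l * s) * zeta n ^ j)%C) n).
  assert (Hc : forall l j, (l <= n)%nat -> Cmod (RtoC (INR l * s) * zeta n ^ j) <= rho).
  { intros l j Hl. rewrite Cmod_circle.
    - rewrite <- Hsn. apply Rmult_le_compat_r; [lra|]. now apply le_INR.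
    - apply Rmult_le_pos; [apply pos_INR|lra]. }
  assert (Hstep : forall l j, Cmod (RtoC (INR (S l) * s) * zeta n ^ j - RtoC (INR l * s) * zeta n ^ j) = s).
  { intros l j. rewrite S_INR.
    replace (_ - _)%C with (s * zeta n ^ j)%C.
    - apply Cmod_circle; lra.
    - rewrite !RtoC_mult, RtoC_plus. ring. }
  (* Circle 0 is the centre, where [smooth_angular] requires [0 < r]; here the crude bound
     [B s + B s^2] per point suffices, since this step occurs only once. *)
  assert (H0 : Cmod (m 1%nat - m 0%nat) <= A).
  { unfold m. rewrite <- csum_minus.
    eapply Rle_trans.
    - apply Cmod_csum_const with (b := B * s + B * s ^ 2). intros j _.
      set (w := (RtoC (INR 1 * s) * zeta n ^ j)%C). set (z := (RtoC (INR 0 * s) * zeta n ^ j)%C).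
      assert (Hw : Cmod w <= rho) by (apply Hc; lia).
      assert (Hz : Cmod z <= rho) by (apply Hc; lia).
      assert (Hwz : Cmod (w - z) = s) by (apply (Hstep 0%nat)).
      destruct (Hf z w Hz Hw) as (_ & H1 & H2).
      replace (f w - f z)%C with (f' z * (w - z) + (f w - f z - f' z * (w - z)))%C by ring.
      eapply Rle_trans; [apply Cmod_triangle|]. rewrite Cmod_mult.
      rewrite Hwz in *. nra.
    - unfold A. replace (INR n * (B * s + B * s ^ 2)) with (B * (INR n * s) + B * (INR n * s) * s) by ring.
      rewrite Hsn.
      assert (s <= rho) by (rewrite <- Hsn; nra).
      assert (0 <= B * rho) by nra. nra. }
  assert (H1 : forall l, (S (S l) <= n)%nat -> Cmod (m (S (S l)) - m (S l)) <= D / INR n).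
  { intros l Hl.
    set (r := INR (S l) * s).
    assert (Hr : 0 < r <= rho).
    { split.
      - apply Rmult_lt_0_compat; [apply lt_0_INR; lia|lra].
      - rewrite <- Hsn. apply Rmult_le_compat_r; [lra|]. apply le_INR; lia. }
    set (S1 := csum (fun j => f' (r * zeta n ^ j) * zeta n ^ j)%C n).
    assert (HS1 : Cmod S1 <= 2 * PI * B * rho).
    { apply smooth_angular with f; try easy. intros; now apply Hf. }
    replace (m (S (S l)) - m (S l))%C with (s * S1 + csum (fun j =>
       f (RtoC (INR (S (S l)) * s) * zeta n ^ j) - f (r * zeta n ^ j) -
       f' (r * zeta n ^ j) * (RtoC (INR (S (S l)) * s) * zeta n ^ j - r * zeta n ^ j))%C n)%C.
    - eapply Rle_trans; [apply Cmod_triangle|].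
      apply Rle_trans with (s * (2 * PI * B * rho) + INR n * (B * s ^ 2)).
      + apply Rplus_le_compat.
        * rewrite Cmod_mult, Cmod_RtoC_pos by lra. apply Rmult_le_compat_l; lra.
        * apply Cmod_csum_const. intros j _.
          eapply Rle_trans; [apply Hf; apply Hc; lia|].
          unfold r. rewrite Hstep. lra.
      + unfold D. right. unfold s. field. lra.
    - unfold S1, m. rewrite !csum_minus, <- csum_scal.
      rewrite (csum_ext (fun i => _ * (_ - _))%C (fun i => s * (f' (r * zeta n ^ i) * zeta n ^ i))%C).
      + fold r. ring.
      + intros i _. unfold r. rewrite (S_INR (S l)), !RtoC_mult, RtoC_plus. ring. }
  assert (H2 : forall l, (S l <= n)%nat -> Cmod (m (S l) - m 0%nat) <= A + INR l * (D / INR n)).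
  { induction l as [|l IH]; intros Hl.
    - simpl INR. lra.
    - replace (m (S (S l)) - m 0%nat)%C with ((m (S (S l)) - m (S l)) + (m (S l) - m 0%nat))%C by ring.
      eapply Rle_trans; [apply Cmod_triangle|].
      specialize (IH ltac:(lia)). specialize (H1 l Hl). rewrite (S_INR l). nra. }
  assert (HD : 0 <= D / INR n).
  { apply Rdiv_le_0_compat; [|lra]. unfold D.
    repeat apply Rmult_le_pos; lra. }
  assert (HF : Cmod (m n - m 0%nat) <= A + D).
  { destruct n as [|l]; [lia|]. eapply Rle_trans; [apply H2; lia|].
    apply Rplus_le_compat_l. apply Rle_trans with (INR (S l) * (D / INR (S l))).
    - apply Rmult_le_compat_r; [easy|]. rewrite S_INR; lra.
    - right. field. lra. }
  replace (circle_mean n rho f - f 0)%C with ((m n - m 0%nat) / INR n)%C.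
  - rewrite Cmod_div by (apply INR_neq_0_C; lia). rewrite Cmod_RtoC_pos by lra.
    apply Rmult_le_compat_r; [left; now apply Rinv_0_lt_compat|easy].
  - unfold circle_mean, m. rewrite Hsn.
    replace (csum (fun j => f (RtoC (INR 0 * s) * zeta n ^ j)%C) n) with (INR n * f 0)%C.
    + field. apply INR_neq_0_C; lia.
    + rewrite <- csum_const. apply csum_ext. intros. f_equal. simpl INR.
      rewrite Rmult_0_l. ring.
Qed.

(** * Products, inverses and powers of smooth functions *)

Lemma smooth_mult (rho : R) (f f' g g' : C -> C) :
  smooth rho f f' -> smooth rho g g' ->
  smooth rho (fun z => f z * g z)%C (fun z => f' z * g z + f z * g' z)%C.
Proof.
  intros [A HA] [B HB].
  exists (A * B + 2 * (A * B) + A * (B + 2 * rho * B) + A * B).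
  intros z w Hz Hw.
  destruct (HA z w Hz Hw) as (A1 & A2 & A3). destruct (HB z w Hz Hw) as (B1 & B2 & B3).
  destruct (HB w z Hw Hz) as (B4 & _ & _).
  assert (PA := Rle_trans _ _ _ (Cmod_ge_0 _) A1). assert (PB := Rle_trans _ _ _ (Cmod_ge_0 _) B1).
  assert (Pr := Rle_trans _ _ _ (Cmod_ge_0 _) Hz).
  assert (PAB : 0 <= A * B) by nra.
  assert (PABr : 0 <= A * (2 * rho * B)) by (repeat apply Rmult_le_pos; lra).
  assert (M1 : Cmod (f z * g z) <= A * B).
  { rewrite Cmod_mult. apply Rmult_le_compat; try apply Cmod_ge_0; easy. }
  assert (M2 : Cmod (f' z * g z + f z * g' z) <= 2 * (A * B)).
  { eapply Rle_trans; [apply Cmod_triangle|]. rewrite !Cmod_mult.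
    replace (2 * (A * B)) with (A * B + A * B) by ring.
    apply Rplus_le_compat; apply Rmult_le_compat; try apply Cmod_ge_0; easy. }
  split; [lra|]. split; [lra|].
  replace (f w * g w - f z * g z - (f' z * g z + f z * g' z) * (w - z))%C with
    (g w * (f w - f z - f' z * (w - z)) + f z * (g w - g z - g' z * (w - z))
     + f' z * (w - z) * (g w - g z))%C by ring.
  set (d := Cmod (w - z)) in *.
  assert (Pd : 0 <= d) by apply Cmod_ge_0.
  assert (Hd : d <= 2 * rho).
  { unfold d. eapply Rle_trans; [apply Cmod_minus_le|]. lra. }
  (* A Lipschitz constant for [g]: the remainder [B d^2] is linear in [d] on the disc because
     [d <= 2 rho]. *)
  assert (Hgd : Cmod (g w - g z) <= (B + 2 * rho * B) * d).
  { replace (g w - g z)%C with (g' z * (w - z) + (g w - g z - g' z * (w - z)))%C by ring.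
    eapply Rle_trans; [apply Cmod_triangle|]. rewrite Cmod_mult. fold d.
    apply Rle_trans with (B * d + B * d ^ 2).
    - apply Rplus_le_compat; [|easy]. apply Rmult_le_compat_r; easy.
    - assert (B * d * d <= B * d * (2 * rho)) by (apply Rmult_le_compat_l; nra). nra. }
  eapply Rle_trans; [apply Cmod_triangle|].
  apply Rle_trans with (B * (A * d ^ 2) + A * (B * d ^ 2) + A * d * ((B + 2 * rho * B) * d)).
  - apply Rplus_le_compat.
    + eapply Rle_trans; [apply Cmod_triangle|]. rewrite !Cmod_mult.
      apply Rplus_le_compat; apply Rmult_le_compat; try apply Cmod_ge_0; easy.
    + rewrite !Cmod_mult. fold d. apply Rmult_le_compat; try apply Cmod_ge_0; try easy.
      * apply Rmult_le_pos; [apply Cmod_ge_0|easy].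
      * apply Rmult_le_compat_r; easy.
  - assert (0 <= d ^ 2) by nra. assert (0 <= A * B * d ^ 2) by nra. nra.
Qed.

Lemma smooth_inv (rho d : R) (f f' : C -> C) :
  0 < d -> (forall z, Cmod z <= rho -> d <= Cmod (f z)) -> smooth rho f f' ->
  smooth rho (fun z => / f z)%C (fun z => - f' z / (f z * f z))%C.
Proof.
  intros Hd Hf [B HB].
  exists (/ d + B / (d * d) + (B * B + B * (B + 2 * rho * B)) / (d * d * d)).
  intros z w Hz Hw.
  destruct (HB z w Hz Hw) as (B1 & B2 & B3).
  assert (Dz := Hf z Hz). assert (Dw := Hf w Hw).
  assert (PB := Rle_trans _ _ _ (Cmod_ge_0 _) B1).
  assert (Pr := Rle_trans _ _ _ (Cmod_ge_0 _) Hz).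
  assert (Nz : f z <> 0) by (apply Cmod_gt_0; lra).
  assert (Nw : f w <> 0) by (apply Cmod_gt_0; lra).
  assert (Pid : 0 < / d) by now apply Rinv_0_lt_compat.
  assert (Pdd : 0 < d * d) by nra.
  assert (Pddd : 0 < d * d * d) by nra.
  assert (PBrB : 0 <= rho * B) by nra.
  assert (PBB : 0 <= B * B + B * (B + 2 * rho * B)) by nra.
  assert (T2 : 0 <= B / (d * d)) by (apply Rdiv_le_0_compat; easy).
  assert (T3 : 0 <= (B * B + B * (B + 2 * rho * B)) / (d * d * d)) by (apply Rdiv_le_0_compat; easy).
  assert (Hdiv : forall x y b e : R, 0 <= x <= b -> 0 < e <= y -> x / y <= b / e).
  { intros x y b e Hx He. unfold Rdiv. apply Rmult_le_compat; try easy.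
    - left; apply Rinv_0_lt_compat; lra.
    - apply Rinv_le_contravar; easy. }
  assert (M1 : Cmod (/ f z) <= / d).
  { rewrite Cmod_inv by easy. apply Rinv_le_contravar; easy. }
  assert (Dzz : d * d <= Cmod (f z) * Cmod (f z)) by (apply Rmult_le_compat; lra).
  assert (M2 : Cmod (- f' z / (f z * f z)) <= B / (d * d)).
  { rewrite Cmod_div by (now apply Cmult_neq_0). rewrite Cmod_opp, Cmod_mult.
    apply Hdiv; split; try apply Cmod_ge_0; easy. }
  split; [lra|]. split; [lra|].
  (* The numerator is visibly of second order: a product of two increments minus a Taylor remainder
     of [f]. The three factors of the denominator are each at least [d], hence the constant over
     [d * d * d]. *)
  replace (/ f w - / f z - - f' z / (f z * f z) * (w - z))%C with
    ((f' z * (w - z) * (f w - f z) - (f w - f z - f' z * (w - z)) * f z) / (f w * f z * f z))%C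
    by (field; split; easy).
  set (e := Cmod (w - z)) in *.
  assert (Pe : 0 <= e) by apply Cmod_ge_0.
  assert (He : e <= 2 * rho).
  { unfold e. eapply Rle_trans; [apply Cmod_minus_le|]. lra. }
  assert (Hfd : Cmod (f w - f z) <= (B + 2 * rho * B) * e).
  { replace (f w - f z)%C with (f' z * (w - z) + (f w - f z - f' z * (w - z)))%C by ring.
    eapply Rle_trans; [apply Cmod_triangle|]. rewrite Cmod_mult. fold e.
    apply Rle_trans with (B * e + B * e ^ 2).
    - apply Rplus_le_compat; [|easy]. apply Rmult_le_compat_r; easy.
    - assert (B * e * e <= B * e * (2 * rho)) by (apply Rmult_le_compat_l; nra). nra. }
  apply Rle_trans with ((B * B + B * (B + 2 * rho * B)) / (d * d * d) * e ^ 2).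
  - rewrite Cmod_div by (repeat apply Cmult_neq_0; easy).
    replace (_ / _ * e ^ 2) with ((B * B + B * (B + 2 * rho * B)) * e ^ 2 / (d * d * d)) by (field; lra).
    apply Hdiv; split; try apply Cmod_ge_0; try easy.
    + eapply Rle_trans; [apply Cmod_minus_le|]. rewrite !Cmod_mult. fold e.
      apply Rle_trans with (B * e * ((B + 2 * rho * B) * e) + B * e ^ 2 * B).
      * apply Rplus_le_compat; apply Rmult_le_compat; try apply Cmod_ge_0; try easy.
        -- apply Rmult_le_pos; [apply Cmod_ge_0|easy].
        -- apply Rmult_le_compat_r; easy.
      * right; ring.
    + rewrite !Cmod_mult, !Rmult_assoc. apply Rmult_le_compat; try lra. 
  - apply Rmult_le_compat_r; [nra|lra].
Qed.

Lemma smooth_pow (rho : R) (n : nat) : 0 <= rho -> exists f', smooth rho (fun z => z ^ n)%C f'.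
Proof.
  intros Hr. induction n as [|n [f' IH]].
  - exists (fun _ => RtoC 0). exists 1. intros z w _ _. simpl.
    rewrite Cmod_1, Cmod_0. replace (_ - _)%C with (RtoC 0) by ring. rewrite Cmod_0.
    assert (0 <= Cmod (w - z)) by apply Cmod_ge_0. split; [lra|]. split; [lra|]. nra.
  - eexists. apply (smooth_mult rho (fun z => z) (fun _ => RtoC 1)); [|exact IH].
    exists (rho + 1). intros z w Hz Hw. rewrite Cmod_1.
    replace (_ - _)%C with (RtoC 0) by ring. rewrite Cmod_0.
    assert (0 <= Cmod (w - z)) by apply Cmod_ge_0. split; [lra|]. split; [lra|].
    apply Rmult_le_pos; [lra|nra].
Qed.

(** * Complex power series on the disc *)

Definition Ctends (u : nat -> C) (l : C) : Prop :=
  forall eps : R, 0 < eps -> exists N : nat, forall n, (N <= n)%nat -> Cmod (u n - l) < eps.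

Lemma pow_n_Cpow (z : C) (n : nat) : @pow_n C_AbsRing z n = (z ^ n)%C.
Proof. induction n as [|n IH]; [reflexivity|]. simpl. now rewrite IH. Qed.

Lemma sum_n_csum (u : nat -> C) (n : nat) :
  @sum_n C_AbelianMonoid u n = csum u (S n).
Proof.
  induction n as [|n IH].
  - rewrite sum_O. simpl. ring.
  - rewrite sum_Sn, IH. reflexivity.
Qed.

Lemma sum_n_rsum (u : nat -> R) (n : nat) : sum_n u n = rsum u (S n).
Proof.
  induction n as [|n IH].
  - rewrite sum_O. simpl. ring.
  - rewrite sum_Sn, IH. reflexivity.
Qed.

(** [sum_n u n] has [n + 1] terms and [csum u n] has [n], which accounts for the index shifts. *)
Lemma is_pseries_Ctends (a : nat -> C) (z l : C) :
  @is_pseries C_AbsRing C_NormedModule a z l <->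
  Ctends (csum (fun i => a i * z ^ i)%C) l.
Proof.
  assert (E : forall n, @sum_n C_AbelianMonoid
      (fun k => @scal C_AbsRing C_NormedModule (@pow_n C_AbsRing z k) (a k)) n
      = csum (fun i => a i * z ^ i)%C (S n)).
  { intros n. rewrite sum_n_csum. apply csum_ext. intros i _. rewrite pow_n_Cpow.
    apply Cmult_comm. }
  unfold is_pseries, is_series.
  etransitivity; [apply (@filterlim_locally_ball_norm C_AbsRing nat C_NormedModule eventually _)|].
  split.
  - intros H eps He. destruct (H (mkposreal eps He)) as [N HN].
    exists (S N). intros n Hn. destruct n as [|n]; [lia|].
    specialize (HN n ltac:(lia)). rewrite <- E. exact HN.
  - intros H eps. destruct (H eps (cond_pos eps)) as [N HN].
    exists N. intros n Hn. specialize (HN (S n) ltac:(lia)). rewrite <- E in HN. exact HN.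
Qed.

Lemma Ctends_ext (u v : nat -> C) (l : C) :
  (forall n, u n = v n) -> Ctends u l -> Ctends v l.
Proof.
  intros E H eps He. destruct (H eps He) as [N HN]. exists N. intros n Hn.
  rewrite <- E. now apply HN.
Qed.

Lemma Ctends_shift (u : nat -> C) (l : C) : Ctends u l -> Ctends (fun n => u (S n)) l.
Proof. intros H eps He. destruct (H eps He) as [N HN]. exists N. intros. apply HN. lia. Qed.

Lemma Ctends_unshift (u : nat -> C) (l : C) : Ctends (fun n => u (S n)) l -> Ctends u l.
Proof.
  intros H eps He. destruct (H eps He) as [N HN]. exists (S N). intros [|n] Hn; [lia|].
  apply HN. lia.
Qed.

Lemma Ctends_const (l : C) : Ctends (fun _ => l) l.
Proof.
  intros eps He. exists O. intros. replace (l - l)%C with (RtoC 0) by ring.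
  now rewrite Cmod_0.
Qed.

Lemma Ctends_plus (u v : nat -> C) (l m : C) :
  Ctends u l -> Ctends v m -> Ctends (fun n => u n + v n)%C (l + m)%C.
Proof.
  intros Hu Hv eps He.
  destruct (Hu (eps / 2)) as [N HN]; [lra|]. destruct (Hv (eps / 2)) as [M HM]; [lra|].
  exists (N + M)%nat. intros n Hn.
  specialize (HN n ltac:(lia)). specialize (HM n ltac:(lia)).
  replace (u n + v n - (l + m))%C with ((u n - l) + (v n - m))%C by ring.
  eapply Rle_lt_trans; [apply Cmod_triangle|]. lra.
Qed.

Lemma Ctends_scal (c : C) (u : nat -> C) (l : C) :
  Ctends u l -> Ctends (fun n => c * u n)%C (c * l)%C.
Proof.
  intros Hu eps He. assert (P := Cmod_ge_0 c).
  destruct (Hu (eps / (Cmod c + 1))) as [N HN]; [apply Rdiv_lt_0_compat; lra|].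
  exists N. intros n Hn. specialize (HN n Hn).
  replace (c * u n - c * l)%C with (c * (u n - l))%C by ring. rewrite Cmod_mult.
  apply Rmult_lt_compat_l with (r := Cmod c + 1) in HN; [|lra].
  replace ((Cmod c + 1) * (eps / (Cmod c + 1))) with eps in HN by (field; lra).
  assert (P' := Cmod_ge_0 (u n - l)). nra.
Qed.

Lemma Ctends_minus (u v : nat -> C) (l m : C) :
  Ctends u l -> Ctends v m -> Ctends (fun n => u n - v n)%C (l - m)%C.
Proof.
  intros Hu Hv. replace (l - m)%C with (l + (-(1)) * m)%C by ring.
  apply Ctends_ext with (fun n => u n + (-(1)) * v n)%C; [intros; ring|].
  apply Ctends_plus; [easy|]. now apply Ctends_scal.
Qed.

Lemma Ctends_Cmod_le (u : nat -> C) (l : C) (B : R) :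
  Ctends u l -> (forall n, Cmod (u n) <= B) -> Cmod l <= B.
Proof.
  intros Hu HB. apply Rle_plus_epsilon. intros eps He.
  destruct (Hu eps He) as [N HN]. specialize (HN N (le_n _)).
  replace l with (u N - (u N - l))%C by ring.
  eapply Rle_trans; [apply Cmod_minus_le|]. specialize (HB N). lra.
Qed.

Lemma csum_succ_l (u : nat -> C) (n : nat) :
  csum u (S n) = (u 0%nat + csum (fun i => u (S i)) n)%C.
Proof. induction n as [|n IH]; [simpl; ring|]. cbn [csum] in *. rewrite IH. ring. Qed.

Lemma rsum_succ_l (u : nat -> R) (n : nat) :
  rsum u (S n) = u 0%nat + rsum (fun i => u (S i)) n.
Proof. induction n as [|n IH]; [simpl; ring|]. cbn [rsum] in *. rewrite IH. ring. Qed.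

Lemma rsum_le_Series (u : nat -> R) (n : nat) :
  (forall i, 0 <= u i) -> ex_series u -> rsum u n <= Series u.
Proof.
  intros Hu He. apply Series_correct in He.
  assert (H : sum_n u n <= Series u).
  { apply (is_lim_seq_incr_compare (sum_n u)); [exact He|].
    intros k. rewrite sum_Sn. unfold plus; simpl. specialize (Hu (S k)). lra. }
  rewrite sum_n_rsum in H. simpl in H. specialize (Hu n). lra.
Qed.

Lemma Series_le_bound (u : nat -> R) (B : R) :
  (forall i, 0 <= u i) -> (forall n, rsum u n <= B) -> ex_series u /\ Series u <= B.
Proof.
  intros Hu HB.
  assert (He : ex_series u).
  { destruct (ex_finite_lim_seq_incr (sum_n u) B) as [l Hl].
    - intros k. rewrite sum_Sn. unfold plus; simpl. specialize (Hu (S k)). lra.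
    - intros k. rewrite sum_n_rsum. apply HB.
    - now exists l. }
  split; [easy|]. apply Series_correct in He.
  apply (is_lim_seq_le (sum_n u) (fun _ => B) (Series u) B).
  - intros k. rewrite sum_n_rsum. apply HB.
  - exact He.
  - apply is_lim_seq_const.
Qed.

Lemma ex_series_Ctends (u : nat -> C) :
  ex_series (fun n => Cmod (u n)) -> exists l, Ctends (csum u) l.
Proof.
  intros H.
  destruct (@ex_series_le C_AbsRing C_CompleteNormedModule u (fun n => Cmod (u n))) as [l Hl].
  - intros n. apply Rle_refl.
  - exact H.
  - exists l. apply Ctends_unshift. intros eps He.
    destruct (proj1 (@filterlim_locally_ball_norm C_AbsRing nat C_NormedModule eventually _ _ _)
      Hl (mkposreal eps He)) as [N HN].
    exists N. intros n Hn. rewrite <- sum_n_csum. exact (HN n Hn).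
Qed.

(** A term is a difference of consecutive partial sums, hence below 2 once these are within 1 of the
    limit; the finitely many earlier terms are bounded by their sum. *)
Lemma power_series_coef_bounded (a : nat -> C) (h : C -> C) (rho : R) :
  power_series_disc a h -> 0 <= rho < 1 ->
  exists M, forall n, Cmod (a n) * rho ^ n <= M.
Proof.
  intros Ha Hr.
  assert (Hd : in_disc rho) by (unfold in_disc; rewrite Cmod_RtoC_pos; lra).
  specialize (Ha rho Hd). apply is_pseries_Ctends in Ha.
  destruct (Ha 1 Rlt_0_1) as [N HN].
  assert (E : forall n, Cmod (a n * rho ^ n) = Cmod (a n) * rho ^ n).
  { intros n. rewrite Cmod_mult, Cmod_pow, Cmod_RtoC_pos; lra. }
  assert (P : forall n, 0 <= Cmod (a n) * rho ^ n).
  { intros n. rewrite <- E. apply Cmod_ge_0. }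
  exists (2 + rsum (fun n => Cmod (a n) * rho ^ n) N). intros n.
  destruct (Nat.le_gt_cases N n) as [Hn|Hn].
  - assert (0 <= rsum (fun n => Cmod (a n) * rho ^ n) N) by (apply rsum_nonneg; intros; apply P).
    rewrite <- E.
    replace (a n * rho ^ n)%C with
      ((csum (fun i => a i * rho ^ i) (S n) - h rho) - (csum (fun i => a i * rho ^ i) n - h rho))%C
      by (simpl; ring).
    assert (H1 := HN n Hn). assert (H2 := HN (S n) ltac:(lia)).
    eapply Rle_trans; [apply Cmod_minus_le|]. lra.
  - apply Rle_trans with (rsum (fun n => Cmod (a n) * rho ^ n) N); [|lra].
    clear HN. induction N as [|N IH]; [lia|]. simpl.
    destruct (Nat.eq_dec n N) as [->|].
    + assert (0 <= rsum (fun n => Cmod (a n) * rho ^ n) N) by (apply rsum_nonneg; intros; apply P).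
      lra.
    + specialize (IH ltac:(lia)). specialize (P N). lra.
Qed.

(** Passing to the real series of moduli makes the real theory of convergence radii available, in
    particular their invariance under formal differentiation. Bounded coefficients at the midpoint
    of [rho] and 1 make the inequality strict. *)
Lemma power_series_radius (a : nat -> C) (h : C -> C) (rho : R) :
  power_series_disc a h -> 0 <= rho < 1 ->
  Rbar_lt (Rabs rho) (CV_radius (fun n => Cmod (a n))).
Proof.
  intros Ha Hr. rewrite Rabs_right by lra.
  apply Rbar_lt_le_trans with (Finite ((1 + rho) / 2)); [simpl; lra|].
  apply (proj1 (CV_radius_bounded (fun n => Cmod (a n)))).
  destruct (power_series_coef_bounded a h ((1 + rho) / 2) Ha ltac:(lra)) as [M HM].
  exists M. intros n. rewrite Rabs_right; [apply HM|].
  apply Rle_ge, Rmult_le_pos; [apply Cmod_ge_0|apply pow_le; lra].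
Qed.

Definition derive_coef (a : nat -> C) (n : nat) : C := (INR (S n) * a (S n))%C.

Lemma Cmod_derive_coef (a : nat -> C) (n : nat) :
  Cmod (derive_coef a n) = PS_derive (fun n => Cmod (a n)) n.
Proof.
  unfold derive_coef, PS_derive. rewrite Cmod_mult, Cmod_RtoC_pos by apply pos_INR.
  reflexivity.
Qed.

(** The remainders satisfy [R_(k+1) = w R_k + k z^(k-1) (w - z)^2]. The constant is twice the
    optimal one, so that it is exactly the factor produced by differentiating the power series
    twice. *)
Lemma Cpow_taylor_bound (rho : R) (z w : C) (n : nat) :
  Cmod z <= rho -> Cmod w <= rho ->
  Cmod (w ^ S (S n) - z ^ S (S n) - INR (S (S n)) * z ^ S n * (w - z))
  <= INR (S n) * INR (S (S n)) * rho ^ n * Cmod (w - z) ^ 2.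
Proof.
  intros Hz Hw. assert (Hr := Rle_trans _ _ _ (Cmod_ge_0 _) Hz).
  induction n as [|n IH].
  - replace (w ^ 2 - z ^ 2 - INR 2 * z ^ 1 * (w - z))%C with ((w - z) ^ 2)%C.
    + rewrite Cmod_pow. simpl. assert (0 <= Cmod (w - z)) by apply Cmod_ge_0. nra.
    + change (INR 2) with (1 + 1). rewrite RtoC_plus. ring.
  - set (k := S (S n)) in *.
    replace (w ^ S k - z ^ S k - INR (S k) * z ^ k * (w - z))%C with
      (w * (w ^ k - z ^ k - INR k * z ^ S n * (w - z)) + INR k * z ^ S n * (w - z) ^ 2)%C.
    + eapply Rle_trans; [apply Cmod_triangle|]. rewrite !Cmod_mult, !Cmod_pow, Cmod_RtoC_pos by apply pos_INR.
      set (D := Cmod (w ^ k - z ^ k - INR k * z ^ S n * (w - z))) in *.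
      set (e := Cmod (w - z)) in *.
      assert (He : 0 <= e ^ 2) by (apply pow2_ge_0).
      apply Rle_trans with (rho * (INR (S n) * INR k * rho ^ n * e ^ 2) + INR k * rho ^ S n * e ^ 2).
      * apply Rplus_le_compat.
        -- apply Rmult_le_compat; try easy; apply Cmod_ge_0.
        -- apply Rmult_le_compat_r; [easy|]. apply Rmult_le_compat_l; [apply pos_INR|].
           apply pow_incr. split; [apply Cmod_ge_0|easy].
      * assert (Ek : INR k = INR (S n) + 1) by apply S_INR.
        rewrite (S_INR k), <- (tech_pow_Rmult rho n).
        assert (0 <= INR k) by apply pos_INR.
        assert (0 <= rho ^ n) by (apply pow_le; easy).
        assert (0 <= INR k * (rho * rho ^ n) * e ^ 2)
          by (apply Rmult_le_pos; [apply Rmult_le_pos; [easy|nra]|easy]).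
        replace (INR (S n)) with (INR k - 1) by lra. nra.
    + rewrite (S_INR k), RtoC_plus. unfold k. simpl Cpow. ring.
Qed.

Lemma power_series_abs_bounds (a : nat -> C) (h : C -> C) (rho : R) :
  power_series_disc a h -> 0 <= rho < 1 ->
  exists B, forall n, rsum (fun i => Cmod (a i) * rho ^ i) n <= B.
Proof.
  intros Ha Hr. eexists. intros n. apply rsum_le_Series.
  - intros i. apply Rmult_le_pos; [apply Cmod_ge_0|apply pow_le; lra].
  - eapply ex_series_ext; [|apply CV_disk_inside, (power_series_radius a h rho Ha Hr)].
    intros i. apply Rabs_right, Rle_ge, Rmult_le_pos; [apply Cmod_ge_0|apply pow_le; lra].
Qed.

Lemma derive_series_converges (a : nat -> C) (h : C -> C) (z : C) :
  power_series_disc a h -> in_disc z ->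
  exists l, Ctends (csum (fun i => derive_coef a i * z ^ i)%C) l.
Proof.
  intros Ha Hz. apply ex_series_Ctends.
  assert (Hr : 0 <= Cmod z < 1) by (split; [apply Cmod_ge_0|exact Hz]).
  assert (R := power_series_radius a h _ Ha Hr). rewrite <- CV_radius_derive in R.
  eapply ex_series_ext; [|apply (CV_disk_inside _ _ R)].
  intros n. simpl. rewrite Cmod_mult, Cmod_pow, Cmod_derive_coef.
  apply Rabs_right, Rle_ge, Rmult_le_pos; [|apply pow_le; lra].
  rewrite <- Cmod_derive_coef. apply Cmod_ge_0.
Qed.

(** Termwise application of [Cpow_taylor_bound]; [B] is the second derivative of the series of
    moduli at [rho]. The slope [l] is any limit of the differentiated series, since this lemma is
    what proves [h] differentiable. *)
Lemma power_series_taylor (a : nat -> C) (h : C -> C) (rho : R) :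
  power_series_disc a h -> 0 <= rho < 1 ->
  exists B, forall z w l, Cmod z <= rho -> Cmod w <= rho ->
    Ctends (csum (fun i => derive_coef a i * z ^ i)%C) l ->
    Cmod (h w - h z - l * (w - z)) <= B * Cmod (w - z) ^ 2.
Proof.
  intros Ha Hr.
  assert (R := power_series_radius a h _ Ha Hr).
  rewrite <- CV_radius_derive, <- CV_radius_derive in R. apply CV_disk_inside in R.
  set (q := PS_derive (PS_derive (fun n => Cmod (a n)))) in *.
  assert (Hq : forall i, 0 <= q i * rho ^ i).
  { intros i. apply Rmult_le_pos; [|apply pow_le; lra].
    unfold q, PS_derive. repeat apply Rmult_le_pos; try apply pos_INR. apply Cmod_ge_0. }
  exists (Series (fun i => q i * rho ^ i)). intros z w l Hz Hw Hl.
  assert (Dz : in_disc z) by (unfold in_disc; lra).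
  assert (Dw : in_disc w) by (unfold in_disc; lra).
  assert (Tz := proj1 (is_pseries_Ctends _ _ _) (Ha z Dz)).
  assert (Tw := proj1 (is_pseries_Ctends _ _ _) (Ha w Dw)).
  assert (Hl' : Ctends (fun n => csum (fun i => derive_coef a i * z ^ i)%C n * (w - z))%C (l * (w - z))%C).
  { rewrite (Cmult_comm l). eapply Ctends_ext; [|apply Ctends_scal, Hl]. intros; apply Cmult_comm. }
  eapply Ctends_Cmod_le.
  (* Partial sums of [n + 2] terms for [h] are paired with [n + 1] terms for the derivative: indices
     0 and 1 leave no remainder, and the other [n] fall under [Cpow_taylor_bound]. *)
  - apply Ctends_minus; [|apply Ctends_shift, Hl'].
    apply Ctends_minus; apply Ctends_shift, Ctends_shift; [exact Tw|exact Tz].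
  - intros n. simpl.
    replace (_ - _)%C with (csum (fun i => a (S (S i)) *
      (w ^ S (S i) - z ^ S (S i) - INR (S (S i)) * z ^ S i * (w - z)))%C n).
    + eapply Rle_trans.
      * apply (Cmod_csum_le _ (fun i => Cmod (w - z) ^ 2 * (q i * rho ^ i))). intros i _.
        rewrite Cmod_mult. eapply Rle_trans.
        -- apply Rmult_le_compat_l; [apply Cmod_ge_0|]. now apply (Cpow_taylor_bound rho).
        -- unfold q, PS_derive. right. ring.
      * rewrite rsum_scal, Rmult_comm. apply Rmult_le_compat_r; [apply pow2_ge_0|].
        apply rsum_le_Series; [exact Hq|].
        eapply ex_series_ext; [|exact R]. intros i. apply Rabs_right, Rle_ge, Hq.
    + rewrite (csum_ext (fun i => a (S (S i)) * _)%C (fun i =>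
        (a (S (S i)) * w ^ S (S i) - a (S (S i)) * z ^ S (S i)) -
        (w - z) * (derive_coef a (S i) * z ^ S i))%C)
        by (intros; unfold derive_coef; ring).
      rewrite !csum_minus, csum_scal.
      change (csum (fun i => a i * w ^ i) n + a n * w ^ n + a (S n) * (w * w ^ n))%C
        with (csum (fun i => a i * w ^ i)%C (S (S n))).
      change (csum (fun i => a i * z ^ i) n + a n * z ^ n + a (S n) * (z * z ^ n))%C
        with (csum (fun i => a i * z ^ i)%C (S (S n))).
      change (csum (fun i => derive_coef a i * z ^ i) n + derive_coef a n * z ^ n)%C
        with (csum (fun i => derive_coef a i * z ^ i)%C (S n)).
      rewrite !csum_succ_l. unfold derive_coef at 2. simpl. ring.
Qed.

Lemma is_derive_of_taylor (h : C -> C) (z l : C) (rho B : R) :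
  Cmod z < rho ->
  (forall w, Cmod w <= rho -> Cmod (h w - h z - l * (w - z)) <= B * Cmod (w - z) ^ 2) ->
  @is_derive C_AbsRing C_NormedModule h z l.
Proof.
  intros Hz Hh. split; [apply is_linear_scal_l|].
  intros x Hx. apply (@is_filter_lim_locally_unique C_AbsRing (AbsRing_NormedModule C_AbsRing)) in Hx.
  subst x. intros eps.
  (* The first entry keeps [w] in the disc where the bound holds; the second turns [B |w - z|^2]
     into [eps |w - z|], with [Rabs B + 1] positive whatever the sign of [B]. *)
  set (d := Rmin (rho - Cmod z) (eps / (Rabs B + 1))).
  assert (PB := Rabs_pos B). assert (Pe := cond_pos eps).
  assert (Hd : 0 < d).
  { apply Rmin_pos; [lra|]. apply Rdiv_lt_0_compat; lra. }
  generalize (@locally_ball_norm C_AbsRing (AbsRing_NormedModule C_AbsRing) z (mkposreal d Hd)).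
  apply filter_imp. intros w Hw.
  change (Cmod (w - z) < d) in Hw.
  change (Cmod (h w - h z - (w - z) * l) <= eps * Cmod (w - z)).
  rewrite (Cmult_comm _ l).
  assert (H1 := Rmin_l (rho - Cmod z) (eps / (Rabs B + 1))).
  assert (H2 := Rmin_r (rho - Cmod z) (eps / (Rabs B + 1))). fold d in H1, H2.
  assert (P := Cmod_ge_0 (w - z)).
  eapply Rle_trans; [apply Hh|].
  - replace w with (z + (w - z))%C by ring. eapply Rle_trans; [apply Cmod_triangle|]. lra.
  - simpl. rewrite Rmult_1_r, <- Rmult_assoc. apply Rmult_le_compat_r; [easy|].
    apply Rle_trans with ((Rabs B + 1) * (eps / (Rabs B + 1))).
    + apply Rle_trans with ((Rabs B + 1) * Cmod (w - z)).
      * apply Rmult_le_compat_r; [easy|]. generalize (Rle_abs B). lra.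
      * apply Rmult_le_compat_l; lra.
    + right. field. lra.
Qed.

Lemma power_series_is_derive (a : nat -> C) (h : C -> C) (z l : C) :
  power_series_disc a h -> in_disc z ->
  Ctends (csum (fun i => derive_coef a i * z ^ i)%C) l ->
  @is_derive C_AbsRing C_NormedModule h z l.
Proof.
  intros Ha Hz Hl. unfold in_disc in Hz. assert (P := Cmod_ge_0 z).
  destruct (power_series_taylor a h ((1 + Cmod z) / 2) Ha ltac:(lra)) as [B HB].
  apply is_derive_of_taylor with ((1 + Cmod z) / 2) B; [lra|].
  intros w Hw. apply HB; [lra|easy|easy].
Qed.

Lemma power_series_derive (a : nat -> C) (h : C -> C) :
  power_series_disc a h -> power_series_disc (derive_coef a) (C_derive h).
Proof.
  intros Ha z Hz. apply is_pseries_Ctends.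
  destruct (derive_series_converges a h z Ha Hz) as [l Hl].
  rewrite (is_C_derive_unique h z l); [exact Hl|].
  now apply power_series_is_derive with a.
Qed.

Lemma power_series_bounded (a : nat -> C) (h : C -> C) (rho : R) :
  power_series_disc a h -> 0 <= rho < 1 ->
  exists B, forall z, Cmod z <= rho -> Cmod (h z) <= B.
Proof.
  intros Ha Hr. destruct (power_series_abs_bounds a h rho Ha Hr) as [B HB].
  exists B. intros z Hz.
  assert (T := proj1 (is_pseries_Ctends _ _ _) (Ha z ltac:(unfold in_disc; lra))).
  apply (Ctends_Cmod_le _ _ _ T). intros n. eapply Rle_trans; [|apply (HB n)].
  apply Cmod_csum_le. intros i _. rewrite Cmod_mult, Cmod_pow.
  apply Rmult_le_compat_l; [apply Cmod_ge_0|]. apply pow_incr.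
  split; [apply Cmod_ge_0|easy].
Qed.

Lemma power_series_smooth (a : nat -> C) (h : C -> C) (rho : R) :
  power_series_disc a h -> 0 <= rho < 1 -> smooth rho h (C_derive h).
Proof.
  intros Ha Hr. assert (Ha' := power_series_derive a h Ha).
  destruct (power_series_bounded _ _ rho Ha Hr) as [B1 H1].
  destruct (power_series_bounded _ _ rho Ha' Hr) as [B2 H2].
  destruct (power_series_taylor _ _ rho Ha Hr) as [B3 H3].
  exists (Rmax B1 (Rmax B2 B3)). intros z w Hz Hw.
  assert (M1 := Rmax_l B1 (Rmax B2 B3)). assert (M2 := Rmax_r B1 (Rmax B2 B3)).
  assert (M3 := Rmax_l B2 B3). assert (M4 := Rmax_r B2 B3).
  split; [specialize (H1 z Hz); lra|]. split; [specialize (H2 z Hz); lra|].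
  eapply Rle_trans; [apply (H3 z w (C_derive h z) Hz Hw)|].
  - apply is_pseries_Ctends, Ha'. unfold in_disc; lra.
  - apply Rmult_le_compat_r; [apply pow2_ge_0|lra].
Qed.

(** * Bessel's inequality for multipliers *)

Lemma Cminus_0_eq (x y : C) : (x - y)%C = 0 -> x = y.
Proof. intros E. rewrite <- (Cplus_0_l y), <- E. ring. Qed.

Lemma csum_at_0 (a : nat -> C) (n : nat) : csum (fun i => a i * 0 ^ i)%C (S n) = a 0%nat.
Proof.
  rewrite csum_succ_l, (csum_ext _ (fun _ => RtoC 0)), csum_const.
  - simpl. ring.
  - intros. simpl. ring.
Qed.

Lemma power_series_at_0 (a : nat -> C) (h : C -> C) : power_series_disc a h -> h 0 = a 0%nat.
Proof.
  intros Ha.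
  assert (T := proj1 (is_pseries_Ctends _ _ _) (Ha 0 ltac:(unfold in_disc; rewrite Cmod_0; lra))).
  apply Ctends_shift in T.
  assert (E : Cmod (h 0 - a 0%nat) <= 0).
  { apply Rle_plus_epsilon. intros eps He.
    destruct (T eps He) as [n Hn]. specialize (Hn n (le_n _)).
    rewrite csum_at_0 in Hn. rewrite Cmod_minus_sym. lra. }
  apply Cminus_0_eq, Cmod_eq_0. generalize (Cmod_ge_0 (h 0 - a 0%nat)). lra.
Qed.

Lemma power_series_tail (a : nat -> C) (h : C -> C) :
  power_series_disc a h ->
  exists h1, power_series_disc (fun n => a (S n)) h1 /\
    forall z, in_disc z -> h z = (a 0%nat + z * h1 z)%C.
Proof.
  intros Ha.
  (* The difference quotient at 0 with its removable singularity filled by the value of the shifted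
     series. *)
  exists (fun z => if Req_EM_T (Cmod z) 0 then a 1%nat else ((h z - a 0%nat) / z)%C).
  split.
  - intros z Hz. apply is_pseries_Ctends.
    assert (T := proj1 (is_pseries_Ctends _ _ _) (Ha z Hz)). apply Ctends_shift in T.
    destruct (Req_EM_T (Cmod z) 0) as [E|E].
    + apply Cmod_eq_0 in E. subst z. apply Ctends_unshift.
      eapply Ctends_ext; [|apply Ctends_const]. intros n. symmetry.
      apply (csum_at_0 (fun n => a (S n))).
    + assert (Nz : z <> 0) by (intros ->; apply E, Cmod_0).
      replace ((h z - a 0%nat) / z)%C with (/ z * (h z - a 0%nat))%C by (field; easy).
      eapply Ctends_ext; [|apply Ctends_scal, Ctends_minus; [exact T|apply Ctends_const]].
      intros n. cbv beta. rewrite csum_succ_l.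
      rewrite (csum_ext (fun i => a (S i) * z ^ S i)%C (fun i => z * (a (S i) * z ^ i))%C)
        by (intros; simpl; ring).
      rewrite csum_scal. simpl. field. easy.
  - intros z Hz. destruct (Req_EM_T (Cmod z) 0) as [E|E].
    + apply Cmod_eq_0 in E. subst z. rewrite (power_series_at_0 a h Ha). ring.
    + assert (Nz : z <> 0) by (intros ->; apply E, Cmod_0). field. easy.
Qed.

Definition Cpoly (p : nat -> C) (n : nat) (z : C) : C := csum (fun i => p i * z ^ i)%C n.

Lemma power_series_split (a : nat -> C) (h : C -> C) (n : nat) :
  power_series_disc a h ->
  exists r, power_series_disc (fun i => a (n + i)%nat) r /\
    forall z, in_disc z -> h z = (Cpoly a n z + z ^ n * r z)%C.
Proof.
  intros Ha. induction n as [|n (r & Hr & E)].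
  - exists h. split; [exact Ha|]. intros z _. unfold Cpoly. simpl. ring.
  - destruct (power_series_tail _ _ Hr) as (r1 & Hr1 & E1).
    exists r1. split.
    + intros z Hz. specialize (Hr1 z Hz). revert Hr1. apply is_series_ext.
      intros i. now replace (n + S i)%nat with (S n + i)%nat by lia.
    + intros z Hz. rewrite (E z Hz), (E1 z Hz), Nat.add_0_r. unfold Cpoly. simpl. ring.
Qed.

Lemma Cmult_conj_circle (z : C) (rho : R) (n : nat) :
  Cmod z = rho -> (z ^ n * Cconj (z ^ n))%C = RtoC (rho ^ (2 * n)).
Proof.
  intros Hz. rewrite <- Cmod2_conj, Cmod_pow, Hz. f_equal. rewrite Nat.mul_comm. symmetry. apply pow_mult.
Qed.

Lemma mean_tends_pow_mult (rho : R) (q q' : C -> C) (n : nat) :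
  0 < rho -> smooth rho q q' -> mean_tends rho (fun z => z ^ S n * q z)%C 0.
Proof.
  intros Hr Hq. destruct (smooth_pow rho (S n)) as [f' Hf]; [lra|].
  replace (RtoC 0) with ((fun z => z ^ S n * q z)%C 0) by (simpl; ring).
  eapply cauchy_mean; [easy|]. apply smooth_mult; [exact Hf|exact Hq].
Qed.

(** On the circle [Cconj (z ^ n)] is [rho ^ (2 * n) / z ^ n], so the integrand agrees there with a
    multiple of [z ^ (m - n) * q z], which vanishes at 0. *)
Lemma mean_tends_high_order (rho : R) (q q' : C -> C) (m n : nat) :
  0 < rho -> (n < m)%nat -> smooth rho q q' ->
  mean_tends rho (fun z => z ^ m * q z * Cconj (z ^ n))%C 0.
Proof.
  intros Hr Hn Hq. replace (RtoC 0) with (RtoC (rho ^ (2 * n)) * 0)%C by ring.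
  apply mean_tends_ext with (fun z => RtoC (rho ^ (2 * n)) * (z ^ S (m - n - 1) * q z))%C; [lra| |].
  - intros z Hz. rewrite <- (Cmult_conj_circle z rho n Hz).
    replace m with (n + S (m - n - 1))%nat at 2 by lia. rewrite Cpow_add_r. ring.
  - apply mean_tends_scal. eapply mean_tends_pow_mult; [easy|exact Hq].
Qed.

Lemma smooth_const (rho : R) (c : C) : smooth rho (fun _ => c) (fun _ => RtoC 0).
Proof.
  exists (Cmod c). intros z w _ _. rewrite Cmod_0. split; [lra|]. split; [apply Cmod_ge_0|].
  replace (_ - _)%C with (RtoC 0) by ring. rewrite Cmod_0.
  apply Rmult_le_pos; [apply Cmod_ge_0|apply pow2_ge_0].
Qed.

Lemma Cconj_0 : Cconj 0 = 0.
Proof. unfold Cconj, RtoC; simpl. f_equal. ring. Qed.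

Lemma mean_tends_monomial (rho : R) (m n : nat) : 0 < rho -> m <> n ->
  mean_tends rho (fun z => z ^ m * Cconj (z ^ n))%C 0.
Proof.
  assert (L : forall m n, 0 < rho -> (n < m)%nat ->
    mean_tends rho (fun z => z ^ m * Cconj (z ^ n))%C 0).
  { intros i j Hr Hij.
    apply mean_tends_ext with (fun z => z ^ i * (fun _ => RtoC 1) z * Cconj (z ^ j))%C;
      [lra|intros; ring|].
    apply mean_tends_high_order with (fun _ => RtoC 0); [easy|easy|apply smooth_const]. }
  intros Hr Hmn. destruct (Nat.lt_gt_cases m n) as [H _]. destruct (H Hmn) as [Hl|Hl].
  - rewrite <- Cconj_0.
    apply mean_tends_ext with (fun z => Cconj (z ^ n * Cconj (z ^ m)))%C; [lra| |].
    + intros z _. rewrite Cmult_conj, Cconj_conj. ring.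
    + apply mean_tends_conj, L; easy.
  - now apply L.
Qed.

Lemma mean_tends_const (rho : R) (c : C) : mean_tends rho (fun _ => c) c.
Proof.
  exists 0. intros n Hn. unfold circle_mean. rewrite csum_const.
  replace (INR n * c / INR n - c)%C with (RtoC 0) by (field; apply INR_neq_0_C; lia).
  rewrite Cmod_0. unfold Rdiv. lra.
Qed.

(** The counterpart of Cauchy's coefficient formula. After splitting off the terms below [n], which
    are orthogonal to [z ^ n], the rest is [z ^ n * s z]; its pairing is [rho ^ (2 * n) * s z],
    whose average tends to [s 0 = a n]. *)
Lemma mean_tends_coef (a : nat -> C) (h : C -> C) (rho : R) (n : nat) :
  power_series_disc a h -> 0 < rho < 1 ->
  mean_tends rho (fun z => h z * Cconj (z ^ n))%C (a n * RtoC (rho ^ (2 * n)))%C.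
Proof.
  intros Ha Hr. destruct (power_series_split a h n Ha) as (s & Hs & Es).
  apply mean_tends_ext with (fun z => Cpoly a n z * Cconj (z ^ n) + z ^ n * s z * Cconj (z ^ n))%C.
  { lra. }
  { intros z Hz. rewrite (Es z) by (unfold in_disc; lra). ring. }
  rewrite <- (Cplus_0_l (a n * _)%C). apply mean_tends_plus.
  - unfold Cpoly.
    assert (L : forall m, (m <= n)%nat ->
      mean_tends rho (fun z => csum (fun i => a i * z ^ i) m * Cconj (z ^ n))%C 0).
    { induction m as [|m IH]; intros Hm; simpl.
      - apply mean_tends_ext with (fun _ => RtoC 0); [lra|intros; ring|apply mean_tends_const].
      - apply mean_tends_ext with (fun z => csum (fun i => a i * z ^ i) m * Cconj (z ^ n)
          + a m * (z ^ m * Cconj (z ^ n)))%C; [lra|intros; ring|].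
        replace (RtoC 0) with (0 + a m * 0)%C by ring.
        apply mean_tends_plus; [apply IH; lia|].
        apply mean_tends_scal, mean_tends_monomial; [lra|lia]. }
    apply L; lia.
  - apply mean_tends_ext with (fun z => RtoC (rho ^ (2 * n)) * s z)%C; [lra| |].
    { intros z Hz. rewrite <- (Cmult_conj_circle z rho n Hz). ring. }
    rewrite Cmult_comm. apply mean_tends_scal.
    replace (a n) with (s 0) by (rewrite (power_series_at_0 _ s Hs); f_equal; lia).
    eapply cauchy_mean; [easy|]. eapply power_series_smooth; [exact Hs|lra].
Qed.

Lemma mean_tends_poly_pairing (rho : R) (F : C -> C) (c s : nat -> C) (n : nat) :
  0 < rho ->
  (forall i, (i < n)%nat ->
     mean_tends rho (fun z => F z * Cconj (z ^ i))%C (c i * RtoC (rho ^ (2 * i)))%C) ->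
  mean_tends rho (fun z => F z * Cconj (Cpoly s n z))%C
    (csum (fun i => c i * Cconj (s i) * RtoC (rho ^ (2 * i)))%C n).
Proof.
  intros Hr. unfold Cpoly. induction n as [|n IH]; intros HF.
  - apply mean_tends_ext with (fun _ => RtoC 0); [lra| |apply mean_tends_const].
    intros z _. simpl. rewrite Cconj_0. ring.
  - apply mean_tends_ext with (fun z => F z * Cconj (csum (fun i => s i * z ^ i) n)
      + Cconj (s n) * (F z * Cconj (z ^ n)))%C; [lra| |].
    + intros z _. cbn [csum]. rewrite Cplus_conj, Cmult_conj. ring.
    + cbn [csum]. apply mean_tends_plus; [apply IH; intros; apply HF; lia|].
      replace (c n * Cconj (s n) * RtoC (rho ^ (2 * n)))%C
        with (Cconj (s n) * (c n * RtoC (rho ^ (2 * n))))%C by ring.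
      apply mean_tends_scal, HF; lia.
Qed.

Lemma mean_tends_poly_coef (rho : R) (p : nat -> C) (n i : nat) :
  0 < rho -> (i < n)%nat ->
  mean_tends rho (fun z => Cpoly p n z * Cconj (z ^ i))%C (p i * RtoC (rho ^ (2 * i)))%C.
Proof.
  intros Hr Hi.
  assert (L : forall m, mean_tends rho (fun z => Cpoly p m z * Cconj (z ^ i))%C
    (if (i <? m)%nat then p i * RtoC (rho ^ (2 * i)) else 0)%C).
  { unfold Cpoly. induction m as [|m IH].
    - apply mean_tends_ext with (fun _ => RtoC 0); [lra| |apply mean_tends_const].
      intros z _. simpl. ring.
    - apply mean_tends_ext with (fun z => csum (fun i => p i * z ^ i) m * Cconj (z ^ i)
        + p m * (z ^ m * Cconj (z ^ i)))%C; [lra|intros; simpl; ring|].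
      destruct (Nat.eq_dec m i) as [->|Hm].
      + rewrite Nat.ltb_irrefl in IH.
        replace (i <? S i)%nat with true by (symmetry; apply Nat.ltb_lt; lia).
        rewrite <- (Cplus_0_l (p i * _)%C). apply mean_tends_plus; [exact IH|].
        apply mean_tends_scal.
        apply mean_tends_ext with (fun _ => RtoC (rho ^ (2 * i))); [lra| |apply mean_tends_const].
        intros z Hz. symmetry. now apply Cmult_conj_circle.
      + replace (i <? S m)%nat with (i <? m)%nat.
        * match goal with |- mean_tends _ _ ?l => replace l with (l + p m * 0)%C by ring end.
          apply mean_tends_plus; [exact IH|]. now apply mean_tends_scal, mean_tends_monomial.
        * destruct (Nat.ltb_spec i m), (Nat.ltb_spec i (S m)); (reflexivity || lia). }
  specialize (L n). now rewrite (proj2 (Nat.ltb_lt i n) Hi) in L.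
Qed.

Lemma csum_RtoC (u : nat -> R) (n : nat) : csum (fun i => RtoC (u i)) n = RtoC (rsum u n).
Proof. induction n as [|n IH]; simpl; [reflexivity|]. now rewrite IH, RtoC_plus. Qed.

Lemma csum_square (p : nat -> C) (rho : R) (n : nat) :
  csum (fun i => p i * Cconj (p i) * RtoC (rho ^ (2 * i)))%C n =
  RtoC (rsum (fun i => Cmod (p i) ^ 2 * rho ^ (2 * i)) n).
Proof.
  rewrite <- csum_RtoC. apply csum_ext. intros i _. rewrite RtoC_mult, Cmod2_conj. reflexivity.
Qed.

(* Bessel's inequality for [omega * P], whose first [n] coefficients are the [g i]:
   the mean of [k^2 |P|^2 - |omega P|^2 + |omega P - Cpoly g|^2] is nonnegative. *)
Lemma multiplier_contraction (rho k : R) (omega : C -> C) (p g : nat -> C) (n : nat) :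
  0 < rho ->
  (forall z, Cmod z = rho -> Cmod (omega z) <= k) ->
  (forall i, (i < n)%nat ->
     mean_tends rho (fun z => omega z * Cpoly p n z * Cconj (z ^ i))%C
       (g i * RtoC (rho ^ (2 * i)))%C) ->
  rsum (fun i => Cmod (g i) ^ 2 * rho ^ (2 * i)) n <=
  k ^ 2 * rsum (fun i => Cmod (p i) ^ 2 * rho ^ (2 * i)) n.
Proof.
  intros Hr Hk HF.
  assert (T1 := mean_tends_poly_pairing rho (Cpoly p n) p p n Hr
    (fun i Hi => mean_tends_poly_coef rho p n i Hr Hi)).
  assert (T2 := mean_tends_poly_pairing rho _ g g n Hr HF).
  assert (T3 := mean_tends_poly_pairing rho (Cpoly g n) g g n Hr
    (fun i Hi => mean_tends_poly_coef rho g n i Hr Hi)).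
  rewrite csum_square in T1, T2, T3.
  set (P := rsum (fun i => Cmod (p i) ^ 2 * rho ^ (2 * i)) n) in *.
  set (G := rsum (fun i => Cmod (g i) ^ 2 * rho ^ (2 * i)) n) in *.
  (* When the quantity described above is expanded, [|omega P|^2] cancels. What is averaged is
     [k^2 |P|^2], minus the pairing [T2] and its conjugate, plus [|Cpoly g|^2], with limit
     [k^2 P - G - G + G]. *)
  assert (T := mean_tends_plus _ _ _ _ _
    (mean_tends_minus _ _ _ _ _ (Rlt_le _ _ Hr) (mean_tends_minus _ _ _ _ _ (Rlt_le _ _ Hr)
       (mean_tends_scal _ (RtoC (k ^ 2)) _ _ T1) T2) (mean_tends_conj _ _ _ T2)) T3).
  apply mean_tends_Re_nonneg in T; [|lra|].
  - revert T. unfold Re, Cmult, Cminus, Cplus, Copp, Cconj, RtoC; simpl. lra.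
  - intros z Hz. specialize (Hk z Hz).
    set (x := Cpoly p n z). set (y := Cpoly g n z). set (o := omega z) in *.
    assert (Po := Cmod_ge_0 o).
    assert (Ho : Cmod o ^ 2 <= k ^ 2) by (apply pow_incr; easy).
    rewrite Cmod2_alt in Ho.
    destruct x as [x1 x2], y as [y1 y2], o as [o1 o2].
    unfold Re, Im, Cmult, Cminus, Cplus, Copp, Cconj, RtoC in *; cbn [fst snd] in *.
    set (k2 := k ^ 2) in *.
    assert (0 <= (k2 - (o1 ^ 2 + o2 ^ 2)) * (x1 ^ 2 + x2 ^ 2)).
    { apply Rmult_le_pos; [lra|]. generalize (pow2_ge_0 x1) (pow2_ge_0 x2). lra. }
    assert (0 <= (o1 * x1 - o2 * x2 - y1) ^ 2) by apply pow2_ge_0.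
    assert (0 <= (o1 * x2 + o2 * x1 - y2) ^ 2) by apply pow2_ge_0.
    nra.
Qed.

Lemma one_minus_pow_ge (t : R) (n : nat) : 0 <= t <= 1 -> 1 - INR n * t <= (1 - t) ^ n.
Proof.
  intros Ht. induction n as [|n IH]; [simpl; lra|].
  rewrite S_INR, <- tech_pow_Rmult.
  assert (0 <= INR n * (t * t)) by (apply Rmult_le_pos; [apply pos_INR|nra]).
  apply Rle_trans with ((1 - t) * (1 - INR n * t)); [lra|]. apply Rmult_le_compat_l; lra.
Qed.

(** Lets [rho] tend to 1 in a finite sum. For [rho = 1 - t] every factor is at least
    [(1 - t)^(2 n)], hence at least [1 - 2 n t] by Bernoulli. *)
Lemma rsum_radial_limit (u : nat -> R) (B : R) (n : nat) :
  (forall i, (i < n)%nat -> 0 <= u i) ->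
  (forall rho, 0 < rho < 1 -> rsum (fun i => u i * rho ^ (2 * i)) n <= B) ->
  rsum u n <= B.
Proof.
  intros Hu HB.
  set (S := rsum u n) in *.
  assert (HS : 0 <= S) by now apply rsum_nonneg.
  apply Rle_plus_epsilon. intros eps He.
  set (m := (2 * n)%nat).
  assert (Pm := pos_INR m).
  assert (HX : S * INR m < (INR m + 1) * (S + 1)) by nra.
  assert (HX0 : 0 <= S * INR m) by (apply Rmult_le_pos; easy).
  (* [D] exceeds [S * m], so [t = eps / D] costs at most [eps]; it also exceeds [eps], so
     [t < 1]. *)
  set (D := (INR m + 1) * (S + 1) + eps).
  assert (HD : 0 < D) by (unfold D; lra).
  assert (HDe : eps < D) by (unfold D; lra).
  set (t := eps / D).
  assert (Ht : 0 < t) by (apply Rdiv_lt_0_compat; lra).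
  assert (Et : t * D = eps) by (unfold t; field; lra).
  assert (Ht1 : t < 1) by nra.
  specialize (HB (1 - t) ltac:(lra)).
  assert (Bern : 1 - INR m * t <= (1 - t) ^ m).
  { apply one_minus_pow_ge; lra. }
  assert (HL : S * (1 - t) ^ m <= rsum (fun i => u i * (1 - t) ^ (2 * i)) n).
  { unfold S. rewrite Rmult_comm, <- rsum_scal. apply rsum_le. intros i Hi.
    rewrite Rmult_comm. apply Rmult_le_compat_l; [now apply Hu|].
    replace m with (2 * i + (m - 2 * i))%nat by (unfold m; lia).
    rewrite pow_add. rewrite <- (Rmult_1_r ((1 - t) ^ (2 * i))) at 2.
    apply Rmult_le_compat_l; [apply pow_le; lra|].
    apply Rle_trans with (1 ^ (m - 2 * i)); [apply pow_incr; lra|rewrite pow1; lra]. }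
  assert (S * (1 - INR m * t) <= B).
  { apply Rle_trans with (S * (1 - t) ^ m); [|lra]. now apply Rmult_le_compat_l. }
  assert (S * INR m * t <= D * t) by (apply Rmult_le_compat_r; unfold D; lra).
  lra.
Qed.

Lemma smooth_lipschitz (rho : R) (f f' : C -> C) :
  0 <= rho -> smooth rho f f' ->
  exists L, 0 <= L /\ forall z w, Cmod z <= rho -> Cmod w <= rho ->
    Cmod (f w - f z) <= L * Cmod (w - z).
Proof.
  intros Hr [B HB].
  assert (Z0 : Cmod 0 <= rho) by (rewrite Cmod_0; lra).
  assert (PB := Rle_trans _ _ _ (Cmod_ge_0 _) (proj1 (HB 0 0 Z0 Z0))).
  exists (B + 2 * rho * B). split; [nra|]. intros z w Hz Hw.
  destruct (HB z w Hz Hw) as (B1 & B2 & B3).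
  set (d := Cmod (w - z)) in *.
  assert (Pd : 0 <= d) by apply Cmod_ge_0.
  assert (Hd : d <= 2 * rho).
  { unfold d. eapply Rle_trans; [apply Cmod_minus_le|]. lra. }
  replace (f w - f z)%C with (f' z * (w - z) + (f w - f z - f' z * (w - z)))%C by ring.
  eapply Rle_trans; [apply Cmod_triangle|]. rewrite Cmod_mult. fold d.
  apply Rle_trans with (B * d + B * d ^ 2).
  - apply Rplus_le_compat; [|easy]. apply Rmult_le_compat_r; easy.
  - assert (B * d * d <= B * d * (2 * rho)) by (apply Rmult_le_compat_l; nra). nra.
Qed.

Lemma Cmod_le_minus_plus (x y : C) : Cmod x <= Cmod (x - y) + Cmod y.
Proof. replace x with ((x - y) + y)%C at 1 by ring. apply Cmod_triangle. Qed.

(** A nonvanishing Lipschitz function on a compact disc has a positive minimum modulus. The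
    compactness theorem gives its nearby point only up to double negation, hence the argument by
    contradiction. *)
Lemma smooth_lower_bound (rho : R) (f f' : C -> C) :
  0 < rho -> smooth rho f f' -> (forall z, Cmod z <= rho -> f z <> 0) ->
  exists d, 0 < d /\ forall z, Cmod z <= rho -> d <= Cmod (f z).
Proof.
  intros Hr Hf Hnz. destruct (smooth_lipschitz rho f f') as (L & HL & HLip); [lra|easy|].
  (* Coordinates within [m] of [(u, v)] give a distance below [2 m]. Inside the disc [f] then drops
     by less than [2 L m], leaving more than [m >= d]. Outside, [2 m] is the distance to the disc,
     so no point of the disc is that close. *)
  set (m := fun u v : R => if Rle_dec (Cmod (u, v)) rho then Cmod (f (u, v)) / (2 * L + 1)
     else (Cmod (u, v) - rho) / 2).
  assert (Hm : forall u v, 0 < m u v).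
  { intros u v. unfold m. destruct (Rle_dec (Cmod (u, v)) rho) as [H|H].
    - apply Rdiv_lt_0_compat; [|lra]. now apply Cmod_gt_0, Hnz.
    - lra. }
  destruct (compactness_value_2d (- rho) rho (- rho) rho (fun u v => mkposreal (m u v) (Hm u v)))
    as [d Hd].
  exists d. split; [apply cond_pos|]. intros [x y] Hz.
  destruct (Rle_dec d (Cmod (f (x, y)))) as [|Hn]; [easy|exfalso].
  assert (Hxy := Rmax_Cmod (x, y)). simpl in Hxy.
  assert (Hx := Rle_trans _ _ _ (Rmax_l _ _) Hxy). assert (Hy := Rle_trans _ _ _ (Rmax_r _ _) Hxy).
  apply (Hd x y); [apply Rabs_le_between; lra|apply Rabs_le_between; lra|].
  intros (u & v & _ & _ & Hu & Hv & Hdm). simpl in Hu, Hv, Hdm.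
  assert (Hdist : Cmod ((x, y) - (u, v)) < 2 * m u v).
  { replace (((x, y) : C) - (u, v))%C with (RtoC (x - u) + Ci * RtoC (y - v))%C
      by (unfold Cplus, Cminus, Cmult, Copp, Ci, RtoC; apply injective_projections; simpl; ring).
    eapply Rle_lt_trans; [apply Cmod_triangle|].
    rewrite Cmod_mult, Cmod_Ci, !Cmod_R. lra. }
  unfold m in Hdist, Hdm. destruct (Rle_dec (Cmod (u, v)) rho) as [H|H].
  - assert (Hl := HLip (x, y) (u, v) Hz H). rewrite (Cmod_minus_sym (u, v)) in Hl.
    assert (Cmod (f (u, v)) <= Cmod (f (u, v) - f (x, y)) + Cmod (f (x, y))).
    { apply Cmod_le_minus_plus. }
    set (e := Cmod (f (u, v)) / (2 * L + 1)) in *.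
    assert (Ee : Cmod (f (u, v)) = 2 * L * e + e) by (unfold e; field; lra).
    nra.
  - assert (Cmod (u, v) <= Cmod ((x, y) - (u, v)) + Cmod (x, y)).
    { rewrite Cmod_minus_sym. apply Cmod_le_minus_plus. }
    lra.
Qed.

(** With [H = P + z^n r] and [P] its Taylor polynomial, [(G / H) P = G - z^n (G / H) r], and the
    last term pairs to 0 with [z ^ i] for [i < n]. The quotient is never expanded in a series:
    smoothness is enough for the averages, and it follows from the lower bound on [H]. *)
Lemma majorant_partial_sums (gc hc : nat -> C) (G H : C -> C) (k : R) (n : nat) :
  power_series_disc gc G -> power_series_disc hc H ->
  (forall z, in_disc z -> H z <> 0) ->
  (forall z, in_disc z -> Cmod (G z / H z) <= k) ->
  rsum (fun i => Cmod (gc i) ^ 2) n <= k ^ 2 * rsum (fun i => Cmod (hc i) ^ 2) n.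
Proof.
  intros HG HH Hnz Hk.
  apply rsum_radial_limit; [intros; apply pow2_ge_0|]. intros rho Hr.
  apply Rle_trans with (k ^ 2 * rsum (fun i => Cmod (hc i) ^ 2 * rho ^ (2 * i)) n).
  - apply multiplier_contraction with (fun z => G z / H z)%C; [lra| |].
    + intros z Hz. apply Hk. unfold in_disc; lra.
    + intros i Hi.
      assert (Sm : 0 <= rho < 1) by lra.
      destruct (power_series_split hc H n HH) as (r & Hr1 & E).
      assert (SH := power_series_smooth _ _ rho HH Sm).
      destruct (smooth_lower_bound rho H _ ltac:(lra) SH) as (d & Hd & HHd).
      { intros z Hz. apply Hnz. unfold in_disc; lra. }
      assert (Sq := smooth_mult _ _ _ _ _ (smooth_mult _ _ _ _ _ (power_series_smooth _ _ rho HG Sm)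
        (smooth_inv rho d H _ Hd HHd SH)) (power_series_smooth _ _ rho Hr1 Sm)).
      assert (T := mean_tends_minus _ _ _ _ _ (proj1 Sm) (mean_tends_coef gc G rho i HG Hr)
         (mean_tends_high_order rho _ _ n i (proj1 Hr) Hi Sq)).
      replace (gc i * RtoC (rho ^ (2 * i)))%C with (gc i * RtoC (rho ^ (2 * i)) - 0)%C by ring.
      revert T. apply mean_tends_ext; [lra|].
      intros z Hz. assert (Hzd : in_disc z) by (unfold in_disc; lra).
      assert (Hz0 := Hnz z Hzd). assert (Ez := E z Hzd).
      replace (z ^ n * (G z * / H z * r z))%C with (G z * / H z * (H z - Cpoly hc n z))%C
        by (rewrite Ez at 2; ring).
      field. easy.
  - apply Rmult_le_compat_l; [apply pow2_ge_0|]. apply rsum_le. intros i _.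
    rewrite <- (Rmult_1_r (Cmod (hc i) ^ 2)) at 2.
    apply Rmult_le_compat_l; [apply pow2_ge_0|].
    rewrite <- (pow1 (2 * i)). apply pow_incr; lra.
Qed.

(** * The Bohr inequality *)

(** Bessel's inequality for [(c0 + c1 z^n) h], whose coefficients up to index [n] are the [g i];
    only indices 0 and [n] are kept. *)
Lemma bounded_two_coefs (a : nat -> C) (h : C -> C) (M : R) (c0 c1 : C) (n : nat) :
  power_series_disc a h -> (forall z, in_disc z -> Cmod (h z) <= M) -> (1 <= n)%nat ->
  Cmod (c0 * a 0%nat) ^ 2 + Cmod (c0 * a n + c1 * a 0%nat) ^ 2 <=
  M ^ 2 * (Cmod c0 ^ 2 + Cmod c1 ^ 2).
Proof.
  intros Ha HM Hn.
  set (p := fun i => if (i =? 0)%nat then c0 else if (i =? n)%nat then c1 else RtoC 0).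
  set (g := fun i => if (i =? n)%nat then (c0 * a n + c1 * a 0%nat)%C else (c0 * a i)%C).
  assert (Ep : forall z, Cpoly p (S n) z = (c0 + c1 * z ^ n)%C).
  { intros z. unfold Cpoly. destruct n as [|m]; [lia|]. rewrite csum_succ_l. cbn [csum].
    rewrite (csum_ext _ (fun _ => RtoC 0)), csum_const.
    - unfold p. simpl. rewrite Nat.eqb_refl. ring.
    - intros i Hi. unfold p. simpl. replace (i =? m)%nat with false.
      + ring.
      + symmetry. apply Nat.eqb_neq. lia. }
  assert (HR : forall rho, 0 < rho < 1 ->
    rsum (fun i => Cmod (g i) ^ 2 * rho ^ (2 * i)) (S n) <=
    M ^ 2 * rsum (fun i => Cmod (p i) ^ 2 * rho ^ (2 * i)) (S n)).
  { intros rho Hr. apply multiplier_contraction with h; [lra| |].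
    - intros z Hz. apply HM. unfold in_disc; lra.
    - intros i Hi.
      apply mean_tends_ext with (fun z => c0 * (h z * Cconj (z ^ i)) + c1 * (z ^ n * h z * Cconj (z ^ i)))%C;
        [lra|intros z _; rewrite Ep; ring|].
      assert (T := mean_tends_coef a h rho i Ha Hr).
      assert (Sh := power_series_smooth a h rho Ha ltac:(lra)).
      unfold g. destruct (Nat.eqb_spec i n) as [->|Hin].
      + replace ((c0 * a n + c1 * a 0%nat) * RtoC (rho ^ (2 * n)))%C with
          (c0 * (a n * RtoC (rho ^ (2 * n))) + c1 * (RtoC (rho ^ (2 * n)) * a 0%nat))%C by ring.
        apply mean_tends_plus; apply mean_tends_scal; [exact T|].
        apply mean_tends_ext with (fun z => RtoC (rho ^ (2 * n)) * h z)%C; [lra| |].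
        * intros z Hz. rewrite <- (Cmult_conj_circle z rho n Hz). ring.
        * apply mean_tends_scal. rewrite <- (power_series_at_0 a h Ha).
          eapply cauchy_mean; [lra|exact Sh].
      + replace (c0 * a i * RtoC (rho ^ (2 * i)))%C
          with (c0 * (a i * RtoC (rho ^ (2 * i))) + c1 * 0)%C by ring.
        apply mean_tends_plus; apply mean_tends_scal; [exact T|].
        eapply mean_tends_high_order; [lra|lia|exact Sh]. }
  assert (HL : rsum (fun i => Cmod (g i) ^ 2) (S n) <= M ^ 2 * rsum (fun i => Cmod (p i) ^ 2) (S n)).
  { apply rsum_radial_limit; [intros; apply pow2_ge_0|]. intros rho Hr.
    eapply Rle_trans; [apply HR, Hr|]. apply Rmult_le_compat_l; [apply pow2_ge_0|].
    apply rsum_le. intros i _. rewrite <- (Rmult_1_r (Cmod (p i) ^ 2)) at 2.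
    apply Rmult_le_compat_l; [apply pow2_ge_0|].
    rewrite <- (pow1 (2 * i)). apply pow_incr; lra. }
  destruct n as [|m]; [lia|]. rewrite (rsum_succ_l (fun i => Cmod (g i) ^ 2)), (rsum_succ_l (fun i => Cmod (p i) ^ 2)) in HL.
  cbn [rsum] in HL.
  rewrite (rsum_ext (fun i => Cmod (p (S i)) ^ 2) (fun _ => 0)) in HL.
  - assert (0 <= rsum (fun i => Cmod (g (S i)) ^ 2) m) by (apply rsum_nonneg; intros; apply pow2_ge_0).
    revert HL. rewrite rsum_const. unfold p, g at 1 3. rewrite Nat.eqb_refl. simpl Nat.eqb. cbv iota.
    lra.
  - intros i Hi. unfold p. simpl. replace (i =? m)%nat with false.
    + rewrite Cmod_0. ring.
    + symmetry. apply Nat.eqb_neq. lia.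
Qed.

(* The test polynomial [c0 + c1 z^n] below is the extremal one: it makes both
   sides agree for disc automorphisms. *)
Lemma bounded_coef_le (a : nat -> C) (h : C -> C) (M : R) (n : nat) :
  power_series_disc a h -> 0 < M -> (forall z, in_disc z -> Cmod (h z) <= M) -> (1 <= n)%nat ->
  Cmod (a n) <= M - Cmod (a 0%nat) ^ 2 / M.
Proof.
  intros Ha HM Hh Hn.
  set (x := Cmod (a 0%nat)). set (A := Cmod (a n)).
  assert (Px : 0 <= x) by apply Cmod_ge_0. assert (PA : 0 <= A) by apply Cmod_ge_0.
  set (s := M ^ 2 - x ^ 2).
  (* The trivial choice gives [x^2 + A^2 <= M^2]. It yields [0 <= s], and [A = 0] in the degenerate
     case [s = 0], where the next inequality says nothing. *)
  assert (H1 := bounded_two_coefs a h M 1 0 n Ha Hh Hn).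
  replace (1 * a n + 0 * a 0%nat)%C with (a n) in H1 by ring.
  rewrite Cmult_1_l, Cmod_1, Cmod_0 in H1. fold x A in H1.
  (* With these constants the coefficient of index [n] becomes [M^2 a_n], and the inequality
     rearranges to [(A M)^2 s <= s^3]. *)
  assert (H2 := bounded_two_coefs a h M s (Cconj (a 0%nat) * a n) n Ha Hh Hn).
  replace (s * a n + Cconj (a 0%nat) * a n * a 0%nat)%C with (RtoC (M ^ 2) * a n)%C in H2.
  2: { unfold s. rewrite RtoC_minus. unfold x. rewrite Cmod2_conj. ring. }
  assert (Ps : 0 <= s) by (unfold s; nra).
  rewrite !Cmod_mult, Cmod_conj, !Cmod_RtoC_pos in H2 by (easy || apply pow2_ge_0).
  fold x A in H2.
  assert (H3 : A * M <= s).
  { destruct (Req_dec s 0) as [E|E].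
    - assert (A ^ 2 <= 0) by (unfold s in E; nra). nra.
    - assert (H4 : (A * M) ^ 2 * s <= s ^ 2 * s) by (unfold s in *; nra).
      assert (H5 : (A * M) ^ 2 <= s ^ 2) by (apply Rmult_le_reg_r with s; lra).
      apply Rsqr_incr_0_var; [|easy]. unfold Rsqr. lra. }
  apply Rmult_le_reg_r with M; [easy|].
  replace ((M - x ^ 2 / M) * M) with s by (unfold s; field; lra). exact H3.
Qed.

(** The induction carries the stronger lower bound [t n * rsum d n], in place of an explicit
    summation by parts. *)
Lemma abel_nonneg (t d : nat -> R) (n : nat) :
  (forall i, 0 <= t i) -> (forall i, t (S i) <= t i) -> (forall m, 0 <= rsum d m) ->
  0 <= rsum (fun i => t i * d i) n.
Proof.
  intros Ht Hm Hd. apply Rle_trans with (t n * rsum d n); [now apply Rmult_le_pos|].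
  induction n as [|n IH]; [simpl; lra|].
  apply Rle_trans with (t n * rsum d (S n)); [now apply Rmult_le_compat_r|]. simpl. lra.
Qed.

(** Sum [2 t u <= u^2 + t^2] against the weights and divide by [2 t]. Since [T] may be 0, this is
    done for [t > T], and [t] then tends to [T]. *)
Lemma weighted_cauchy_schwarz (w u : nat -> R) (T : R) (n : nat) :
  (forall i, 0 <= w i) -> 0 <= T ->
  rsum (fun i => w i * u i ^ 2) n <= T ^ 2 * rsum w n ->
  rsum (fun i => w i * u i) n <= T * rsum w n.
Proof.
  intros Hw HT H. set (W := rsum w n) in *.
  assert (HW : 0 <= W) by (apply rsum_nonneg; easy).
  assert (Ht : forall t, T < t -> rsum (fun i => w i * u i) n <= t * W).
  { intros t Htt. apply Rmult_le_reg_l with (2 * t); [lra|].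
    rewrite <- rsum_scal.
    apply Rle_trans with (rsum (fun i => w i * u i ^ 2 + t ^ 2 * w i) n).
    - apply rsum_le. intros i _. specialize (Hw i).
      assert (0 <= w i * (u i - t) ^ 2) by (apply Rmult_le_pos; [easy|apply pow2_ge_0]). lra.
    - rewrite rsum_plus, rsum_scal. fold W.
      assert (T ^ 2 * W <= t ^ 2 * W) by (apply Rmult_le_compat_r; [easy|apply pow_incr; lra]).
      lra. }
  apply Rle_plus_epsilon. intros eps He.
  specialize (Ht (T + eps / (W + 1))).
  assert (0 < eps / (W + 1)) by (apply Rdiv_lt_0_compat; lra).
  assert (eps / (W + 1) * W <= eps).
  { apply Rle_trans with (eps / (W + 1) * (W + 1)); [nra|]. right. field. lra. }
  nra.
Qed.

(* Comparing the coefficients of [g'] and [h'] gives weights [(i+1)^2]; Abel summation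
   trades them for arbitrary nonincreasing weights. *)
Lemma dilatation_weighted_sum (an bn : nat -> C) (h g : C -> C) (k A : R) (w : nat -> R) (n : nat) :
  power_series_disc an h -> power_series_disc bn g ->
  (forall z, in_disc z -> C_derive h z <> 0) ->
  (forall z, in_disc z -> Cmod (C_derive g z / C_derive h z) <= k) ->
  0 <= k -> 0 <= A -> (forall i, Cmod (an (S i)) <= A) ->
  (forall i, 0 <= w i) -> (forall i, w (S i) <= w i) ->
  rsum (fun i => w i * Cmod (bn (S i))) n <= k * A * rsum w n.
Proof.
  intros Hh Hg Hnz Hk Pk PA HA Pw Mw.
  apply weighted_cauchy_schwarz; [easy|now apply Rmult_le_pos|].
  assert (P : forall i, 0 < INR (S i)) by (intros; apply lt_0_INR; lia).
  assert (Hab := abel_nonneg (fun i => w i / INR (S i) ^ 2)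
    (fun i => INR (S i) ^ 2 * (k ^ 2 * Cmod (an (S i)) ^ 2 - Cmod (bn (S i)) ^ 2)) n).
  assert (Hd : 0 <= rsum (fun i => w i * (k ^ 2 * Cmod (an (S i)) ^ 2 - Cmod (bn (S i)) ^ 2)) n).
  { erewrite rsum_ext; [apply Hab|].
    - intros i. apply Rdiv_le_0_compat; [easy|]. apply pow_lt, P.
    - intros i. unfold Rdiv. apply Rmult_le_compat; try easy.
      + left. apply Rinv_0_lt_compat, pow_lt, P.
      + apply Rinv_le_contravar; [apply pow_lt, P|]. apply pow_incr. split; [left; apply P|].
        apply le_INR; lia.
    - intros m.
      assert (H := majorant_partial_sums _ _ _ _ k m (power_series_derive bn g Hg)
        (power_series_derive an h Hh) Hnz Hk).
      rewrite <- rsum_scal in H.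
      rewrite (rsum_ext _ (fun i => k ^ 2 * Cmod (derive_coef an i) ^ 2 + (-1) * Cmod (derive_coef bn i) ^ 2)).
      + rewrite rsum_plus, rsum_scal with (c := -1). lra.
      + intros i _. rewrite !Cmod_derive_coef. unfold PS_derive. ring.
    - intros i _. cbv beta. specialize (P i). field. lra. }
  rewrite (rsum_ext _ (fun i => w i * (k ^ 2 * Cmod (an (S i)) ^ 2) + (-1) * (w i * Cmod (bn (S i)) ^ 2))) in Hd
    by (intros; ring).
  rewrite rsum_plus, rsum_scal in Hd.
  apply Rle_trans with (rsum (fun i => w i * (k ^ 2 * Cmod (an (S i)) ^ 2)) n); [lra|].
  rewrite <- rsum_scal. apply rsum_le. intros i _. rewrite Rmult_comm.
  apply Rmult_le_compat_r; [easy|]. rewrite Rpow_mult_distr.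
  apply Rmult_le_compat_l; [apply pow2_ge_0|]. apply pow_incr. split; [apply Cmod_ge_0|apply HA].
Qed.

(** * Hypergeometric coefficients, the supremum norm and the power inequality *)

Lemma pochhammer_pos (a : R) (n : nat) : 0 < a -> 0 < pochhammer a n.
Proof.
  intros Ha. induction n as [|n IH]; simpl; [lra|].
  apply Rmult_lt_0_compat; [easy|]. generalize (pos_INR n). lra.
Qed.

Lemma hyp_coef_pos (a b c : R) (n : nat) : 0 < a -> 0 < b -> 0 < c -> 0 < hyp_coef a b c n.
Proof.
  intros. unfold hyp_coef. apply Rdiv_lt_0_compat; apply Rmult_lt_0_compat;
    apply pochhammer_pos; lra.
Qed.

Lemma hyp_coef_0 (a b c : R) : hyp_coef a b c 0 = 1.
Proof. unfold hyp_coef. simpl. field. Qed.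

Lemma hyp_coef_decr (a b c : R) (n : nat) :
  0 < a -> 0 < b -> 0 < c -> (a + INR n) * (b + INR n) <= (c + INR n) * (1 + INR n) ->
  hyp_coef a b c (S n) <= hyp_coef a b c n.
Proof.
  intros Ha Hb Hc H. assert (Pn := pos_INR n).
  assert (P := hyp_coef_pos a b c n Ha Hb Hc).
  assert (Pc := pochhammer_pos c n Hc). assert (P1 := pochhammer_pos 1 n Rlt_0_1).
  assert (PD : 0 < (c + INR n) * (1 + INR n)) by (apply Rmult_lt_0_compat; lra).
  replace (hyp_coef a b c (S n)) with
    (hyp_coef a b c n * ((a + INR n) * (b + INR n) / ((c + INR n) * (1 + INR n)))).
  - rewrite <- (Rmult_1_r (hyp_coef a b c n)) at 2. apply Rmult_le_compat_l; [lra|].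
    apply Rmult_le_reg_r with ((c + INR n) * (1 + INR n)); [easy|].
    unfold Rdiv. rewrite Rmult_assoc, Rinv_l; lra.
  - unfold hyp_coef. simpl. field. repeat split; lra.
Qed.

Lemma sup_norm_ge (h : C -> C) (z : C) : bounded_disc h -> in_disc z -> Cmod (h z) <= sup_norm h.
Proof.
  intros [B HB] Hz. unfold sup_norm.
  destruct (Lub_Rbar_correct (fun x => exists z, in_disc z /\ x = Cmod (h z))) as [H1 H2].
  specialize (H1 (Cmod (h z)) (ex_intro _ z (conj Hz eq_refl))).
  specialize (H2 (Finite B)). destruct (Lub_Rbar _) as [l| |]; simpl in *; try easy.
  exfalso. apply H2. intros x (y & Hy & ->). apply HB, Hy.
Qed.

Lemma sup_norm_le (h : C -> C) (B : R) :
  (forall z, in_disc z -> Cmod (h z) <= B) -> sup_norm h <= B.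
Proof.
  intros HB. unfold sup_norm.
  destruct (Lub_Rbar_correct (fun x => exists z, in_disc z /\ x = Cmod (h z))) as [H1 H2].
  (* A point of the disc excludes the supremum minus infinity, and the bound [B] excludes plus
     infinity; so [real] returns the true supremum. *)
  assert (D0 : in_disc 0) by (unfold in_disc; rewrite Cmod_0; lra).
  specialize (H1 (Cmod (h 0)) (ex_intro _ (RtoC 0) (conj D0 eq_refl))).
  specialize (H2 (Finite B)). destruct (Lub_Rbar _) as [l| |]; simpl in *; try easy.
  - apply H2. intros x (y & Hy & ->). apply HB, Hy.
  - exfalso. apply H2. intros x (y & Hy & ->). apply HB, Hy.
Qed.

Lemma exp_ge_tangent (x y : R) : exp y * (1 + (x - y)) <= exp x.
Proof.
  replace x with (y + (x - y)) at 2 by ring. rewrite exp_plus.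
  apply Rmult_le_compat_l; [left; apply exp_pos|]. apply exp_ineq1_le.
Qed.

(** Convexity of [exp] between [2 ln x] and 0 with weights [p / 2] and [1 - p / 2], the latter
    nonnegative as [p <= 2]. Both tangent inequalities are taken at the convex combination, so their
    linear parts cancel. *)
Lemma Rpower_bernoulli (x p : R) : 0 < x -> 0 <= p <= 2 ->
  Rpower x p <= 1 - p / 2 * (1 - x ^ 2).
Proof.
  intros Hx Hp. unfold Rpower.
  replace (x ^ 2) with (exp (2 * ln x)).
  - set (l := 2 * ln x). replace (p * ln x) with (p / 2 * l) by (unfold l; field).
    assert (H1 := exp_ge_tangent l (p / 2 * l)). assert (H2 := exp_ge_tangent 0 (p / 2 * l)).
    rewrite exp_0 in H2. set (e := exp (p / 2 * l)) in *.
    apply Rmult_le_compat_l with (r := p / 2) in H1; [|lra].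
    apply Rmult_le_compat_l with (r := 1 - p / 2) in H2; [|lra].
    lra.
  - replace (2 * ln x) with (ln x + ln x) by ring. rewrite exp_plus, exp_ln by easy. ring.
Qed.

(** Writing [x = M y] splits [x^p] into [M^p y^p]; the hypothesis on [M] replaces [M^p] by [M],
    after which everything is homogeneous and [Rpower_bernoulli] applies to [y]. *)
Lemma rpow_scaled_le (M x p : R) :
  0 < M -> 0 <= x <= M -> 0 < p <= 2 -> rpow M p <= M ->
  rpow x p + p / 2 * (M - x ^ 2 / M) <= M.
Proof.
  intros HM Hx Hp. unfold rpow.
  destruct (Rle_dec M 0); [lra|]. intros HMp.
  destruct (Rle_dec x 0) as [H|H].
  - replace x with 0 by lra. replace (M - 0 ^ 2 / M) with M by (field; lra).
    nra.
  - set (y := x / M). assert (Hy : 0 < y) by (apply Rdiv_lt_0_compat; lra).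
    assert (Ex : x = M * y) by (unfold y; field; lra).
    assert (B := Rpower_bernoulli y p Hy ltac:(lra)).
    rewrite Ex at 1. rewrite <- Rpower_mult_distr by easy.
    replace (M - x ^ 2 / M) with (M * (1 - y ^ 2)) by (rewrite Ex; field; lra).
    assert (PB : 0 < Rpower y p) by apply exp_pos.
    assert (Rpower M p * Rpower y p <= M * (1 - p / 2 * (1 - y ^ 2))).
    { apply Rmult_le_compat; try lra. left; apply exp_pos. }
    lra.
Qed.

(** * The function F - 1 as a series without constant term *)

Definition tail_series (gam : nat -> R) (x : R) : R := Series (fun n => gam (S n) * x ^ S n).

Lemma ex_tail_series (gam : nat -> R) (x : R) :
  (forall n, 0 <= gam n <= 1) -> 0 <= x < 1 -> ex_series (fun n => gam (S n) * x ^ S n).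
Proof.
  intros Hg Hx. apply (@ex_series_le R_AbsRing R_CompleteNormedModule) with (fun n => x ^ n).
  - intros n. change (Rabs (gam (S n) * x ^ S n) <= x ^ n).
    assert (0 <= x ^ n) by (apply pow_le; lra). specialize (Hg (S n)).
    rewrite <- tech_pow_Rmult, Rabs_right.
    + rewrite <- (Rmult_1_l (x ^ n)) at 2. rewrite <- Rmult_assoc.
      apply Rmult_le_compat_r; [easy|]. rewrite <- (Rmult_1_l 1). apply Rmult_le_compat; lra.
    + apply Rle_ge. repeat apply Rmult_le_pos; lra.
  - apply ex_series_geom. rewrite Rabs_right; lra.
Qed.

(** All exponents are at least 1, so [(x / y)^n <= x / y]. This one inequality yields both
    monotonicity and, where the series is positive, strict monotonicity. *)
Lemma tail_series_ratio (gam : nat -> R) (x y : R) :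
  (forall n, 0 <= gam n <= 1) -> 0 <= x <= y -> 0 < y < 1 ->
  tail_series gam x <= x / y * tail_series gam y.
Proof.
  intros Hg Hx Hy. unfold tail_series. rewrite <- Series_scal_l. apply Series_le.
  - intros n. specialize (Hg (S n)). split.
    + apply Rmult_le_pos; [lra|apply pow_le; lra].
    + set (q := x / y).
      assert (Hq : 0 <= q <= 1).
      { unfold q. split; [apply Rdiv_le_0_compat; lra|]. apply Rmult_le_reg_r with y; [lra|].
        unfold Rdiv. rewrite Rmult_assoc, Rinv_l; lra. }
      assert (Ex : x = q * y) by (unfold q; field; lra).
      rewrite Ex, Rpow_mult_distr.
      replace (q * (gam (S n) * y ^ S n)) with (gam (S n) * (q * y ^ S n)) by ring.
      apply Rmult_le_compat_l; [lra|]. apply Rmult_le_compat_r; [apply pow_le; lra|].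
      simpl. rewrite <- (Rmult_1_r q) at 3. apply Rmult_le_compat_l; [lra|].
      rewrite <- (pow1 n). apply pow_incr; lra.
  - apply (ex_series_scal_l (V := R_NormedModule)). apply ex_tail_series; [easy|lra].
Qed.

Lemma tail_series_nonneg (gam : nat -> R) (x : R) :
  (forall n, 0 <= gam n <= 1) -> 0 <= x < 1 -> 0 <= tail_series gam x.
Proof.
  intros Hg Hx. apply (rsum_le_Series _ 0%nat); [|now apply ex_tail_series].
  intros n. apply Rmult_le_pos; [apply Hg|apply pow_le; lra].
Qed.

Lemma tail_series_le (gam : nat -> R) (x y : R) :
  (forall n, 0 <= gam n <= 1) -> 0 <= x <= y -> 0 < y < 1 -> tail_series gam x <= tail_series gam y.
Proof.
  intros Hg Hx Hy. eapply Rle_trans; [now apply tail_series_ratio with (y := y)|].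
  rewrite <- Rmult_1_l. apply Rmult_le_compat_r; [apply tail_series_nonneg; [easy|lra]|].
  apply Rmult_le_reg_r with y; [lra|]. unfold Rdiv. rewrite Rmult_assoc, Rinv_l; lra.
Qed.

Lemma tail_series_lt (gam : nat -> R) (x y : R) :
  (forall n, 0 <= gam n <= 1) -> 0 < x < y -> y < 1 -> 0 < tail_series gam x ->
  tail_series gam x < tail_series gam y.
Proof.
  intros Hg Hx Hy P. assert (H := tail_series_ratio gam x y Hg ltac:(lra) ltac:(lra)).
  apply Rmult_le_compat_l with (r := y) in H; [|lra].
  replace (y * (x / y * tail_series gam y)) with (x * tail_series gam y) in H by (field; lra).
  nra.
Qed.

Lemma hyp2F1_tail (a b c x : R) :
  (forall n, 0 <= hyp_coef a b c n <= 1) -> 0 <= x < 1 ->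
  hyp2F1 a b c x - 1 = tail_series (hyp_coef a b c) x.
Proof.
  intros Hg Hx. unfold hyp2F1, PSeries, tail_series. rewrite Series_incr_1.
  - rewrite hyp_coef_0. simpl. ring.
  - apply ex_series_incr_1. now apply ex_tail_series.
Qed.

Lemma bohr_inequality_holds (gam : nat -> R) (K p r : R) (f h g : C -> C) (an bn : nat -> C) :
  1 <= K -> 0 < p <= 2 -> 0 <= r < 1 ->
  (forall n, 0 <= gam n <= 1) -> (forall n, gam (S n) <= gam n) ->
  tail_series gam r <= p * (K + 1) / (4 * K) ->
  admissible K p f h g an bn -> bohr_inequality gam p h an bn r.
Proof.
  intros HK Hp Hr Hg Mg HW ((_ & _ & Hh & Hgs & _ & _) & Hsp & Hqc & Hb & HM).
  set (M := sup_norm h) in *.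
  assert (HhM : forall z, in_disc z -> Cmod (h z) <= M) by (intros; now apply sup_norm_ge).
  assert (D0 : in_disc 0) by (unfold in_disc; rewrite Cmod_0; lra).
  assert (Hnz : forall z, in_disc z -> C_derive h z <> 0).
  { intros z Hz E. specialize (Hsp z Hz). rewrite E, Cmod_0 in Hsp.
    generalize (pow2_ge_0 (Cmod (C_derive g z))). lra. }
  assert (PM0 : 0 <= M) by (eapply Rle_trans; [apply Cmod_ge_0|apply (HhM 0 D0)]).
  (* If [M = 0], Bessel's inequality with [c0 = 1], [c1 = 0] forces [a_1 = 0], while [a_1 = h'(0)]
     is nonzero for a sense-preserving map. *)
  assert (PM : 0 < M).
  { destruct PM0 as [|E]; [easy|exfalso].
    assert (H := bounded_two_coefs an h M 1 0 1 Hh HhM (le_n _)).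
    rewrite <- E, Cmod_1, Cmod_0 in H.
    apply (Hnz 0 D0). rewrite (power_series_at_0 _ _ (power_series_derive an h Hh)).
    unfold derive_coef. simpl INR. rewrite Cmult_1_l. apply Cmod_eq_0.
    replace (1 * an 1%nat + 0 * an 0%nat)%C with (an 1%nat) in H by ring.
    generalize (pow2_ge_0 (Cmod (1 * an 0%nat))) (Cmod_ge_0 (an 1%nat)). nra. }
  set (x := Cmod (an 0%nat)).
  assert (Hx : 0 <= x <= M).
  { split; [apply Cmod_ge_0|]. unfold x. rewrite <- (power_series_at_0 an h Hh). now apply HhM. }
  set (A := M - x ^ 2 / M).
  assert (HA : forall i, Cmod (an (S i)) <= A).
  { intros i. apply bounded_coef_le with h; try easy. lia. }
  assert (PA : 0 <= A) by (eapply Rle_trans; [apply Cmod_ge_0|apply (HA 0%nat)]).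
  set (k := (K - 1) / (K + 1)) in *.
  assert (Pk : 0 <= k) by (apply Rdiv_le_0_compat; lra).
  set (w := fun i => gam (S i) * r ^ S i).
  assert (Pr : forall i, 0 <= r ^ i) by (intros; apply pow_le; lra).
  assert (Pw : forall i, 0 <= w i) by (intros; apply Rmult_le_pos; [apply Hg|apply Pr]).
  assert (Mw : forall i, w (S i) <= w i).
  { intros i. unfold w. apply Rmult_le_compat; [apply Hg|apply Pr|apply Mg|].
    rewrite <- (tech_pow_Rmult r (S i)). specialize (Pr (S i)). nra. }
  set (W := tail_series gam r) in *.
  assert (HWn : forall n, rsum w n <= W).
  { intros n. apply rsum_le_Series; [easy|]. now apply ex_tail_series. }
  destruct (Series_le_bound (fun n => gam (S n) * Cmod (an (S n)) * r ^ S n) (A * W)) as [Eu Bu].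
  { intros i. apply Rmult_le_pos; [apply Rmult_le_pos; [apply Hg|apply Cmod_ge_0]|apply Pr]. }
  { intros n. apply Rle_trans with (A * rsum w n); [|now apply Rmult_le_compat_l].
    rewrite <- rsum_scal. apply rsum_le. intros i _.
    replace (gam (S i) * Cmod (an (S i)) * r ^ S i) with (Cmod (an (S i)) * w i) by (unfold w; ring).
    now apply Rmult_le_compat_r. }
  destruct (Series_le_bound (fun n => gam (S n) * Cmod (bn (S n)) * r ^ S n) (k * A * W)) as [Ev Bv].
  { intros i. apply Rmult_le_pos; [apply Rmult_le_pos; [apply Hg|apply Cmod_ge_0]|apply Pr]. }
  { intros n. apply Rle_trans with (k * A * rsum w n).
    - rewrite (rsum_ext _ (fun i => w i * Cmod (bn (S i)))) by (intros; unfold w; ring).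
      now apply dilatation_weighted_sum with an h g.
    - apply Rmult_le_compat_l; [now apply Rmult_le_pos|easy]. }
  split; [exact Eu|]. split; [exact Ev|].
  assert (H := rpow_scaled_le M x p PM Hx Hp HM). fold M x. fold A in H.
  (* The two series contribute [A W] and [k A W]; the factor [1 + k] turns [p (K + 1) / (4 K)] into
     [p / 2]. *)
  assert (A * ((1 + k) * W) <= A * (p / 2)).
  { apply Rmult_le_compat_l; [easy|].
    replace (p / 2) with ((1 + k) * (p * (K + 1) / (4 * K))) by (unfold k; field; lra).
    apply Rmult_le_compat_l; lra. }
  lra.
Qed.

(** * Sharpness *)

Definition mobius (al : R) (z : C) : C := ((al - z) / (1 - al * z))%C.

Lemma mobius_denom_ge (al : R) (z : C) : 0 < al < 1 -> Cmod z <= 1 -> 1 - al <= Cmod (1 - al * z).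
Proof.
  intros Hal Hz. assert (H := Cmod_le_minus_plus 1 (al * z)).
  rewrite Cmod_1, Cmod_mult, Cmod_RtoC_pos in H by lra.
  assert (al * Cmod z <= al * 1) by (apply Rmult_le_compat_l; lra). lra.
Qed.

Lemma mobius_denom_neq_0 (al : R) (z : C) :
  0 < al < 1 -> Cmod z <= 1 -> (1 - al * z)%C <> 0.
Proof.
  intros Hal Hz. apply Cmod_gt_0. generalize (mobius_denom_ge al z Hal Hz). lra.
Qed.

Lemma Cmod_mobius_le (al : R) (z : C) : 0 < al < 1 -> in_disc z -> Cmod (mobius al z) <= 1.
Proof.
  intros Hal Hz. unfold in_disc in Hz.
  assert (Hz1 : Cmod z <= 1) by lra.
  assert (Hd := mobius_denom_ge al z Hal Hz1). assert (Nz := mobius_denom_neq_0 al z Hal Hz1).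
  unfold mobius. rewrite Cmod_div by easy.
  apply Rmult_le_reg_r with (Cmod (1 - al * z)); [lra|].
  unfold Rdiv. rewrite Rmult_assoc, Rinv_l, Rmult_1_r, Rmult_1_l by lra.
  apply Rsqr_incr_0_var; [|lra]. rewrite !Rsqr_pow2.
  assert (Hq : Cmod z ^ 2 <= 1 ^ 2) by (apply pow_incr; split; [apply Cmod_ge_0|lra]).
  rewrite !Cmod2_alt in *. destruct z as [x y].
  unfold Re, Im, Cminus, Cplus, Cmult, Copp, RtoC in *; cbn [fst snd] in *.
  (* This product equals [|1 - al z|^2 - |al - z|^2]. *)
  assert (0 <= (1 - al ^ 2) * (1 - (x ^ 2 + y ^ 2))) by (apply Rmult_le_pos; nra).
  nra.
Qed.

(** The value 1 is approached at [z = - t] as [t] tends to 1, because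
    [(al + t) / (1 + al t) >= t]. *)
Lemma sup_norm_mobius (al : R) : 0 < al < 1 -> sup_norm (mobius al) = 1.
Proof.
  intros Hal. apply Rle_antisym.
  - apply sup_norm_le. intros z Hz. now apply Cmod_mobius_le.
  - apply Rle_plus_epsilon. intros eps He.
    set (t := 1 - Rmin eps (1 / 2)).
    assert (H1 := Rmin_l eps (1 / 2)). assert (H2 := Rmin_r eps (1 / 2)).
    assert (H3 : 0 < Rmin eps (1 / 2)) by (apply Rmin_pos; lra).
    assert (Ht : 0 < t < 1) by (unfold t; lra).
    assert (Hd : in_disc (RtoC (- t))) by (unfold in_disc; rewrite Cmod_R, Rabs_Ropp, Rabs_right; lra).
    assert (Hs : Cmod (mobius al (RtoC (- t))) <= sup_norm (mobius al)).
    { apply sup_norm_ge; [|easy]. exists 1. intros z Hz. now apply Cmod_mobius_le. }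
    assert (Pd : 0 < 1 + al * t) by nra.
    replace (mobius al (RtoC (- t))) with (RtoC ((al + t) / (1 + al * t))) in Hs.
    + rewrite Cmod_RtoC_pos in Hs by (apply Rdiv_le_0_compat; lra).
      assert (t <= (al + t) / (1 + al * t)).
      { apply Rmult_le_reg_r with (1 + al * t); [easy|].
        unfold Rdiv. rewrite Rmult_assoc, Rinv_l by lra.
        assert (0 <= al * (1 - t * t)) by (apply Rmult_le_pos; nra). lra. }
      unfold t in *. lra.
    + unfold mobius. rewrite RtoC_div by lra. rewrite !RtoC_plus, RtoC_mult, RtoC_opp.
      f_equal; ring.
Qed.

Definition mobius_coef (al : R) (n : nat) : C :=
  match n with O => RtoC al | S m => RtoC (- (1 - al ^ 2) * al ^ m) end.

Lemma Ctends_pow (q : C) : Cmod q < 1 -> Ctends (fun n => q ^ n)%C 0.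
Proof.
  intros Hq eps He.
  destruct (pow_lt_1_zero (Cmod q)) with (y := eps) as [N HN]; [|easy|].
  - rewrite Rabs_right; [easy|]. apply Rle_ge, Cmod_ge_0.
  - exists N. intros n Hn. specialize (HN n Hn).
    replace (q ^ n - 0)%C with (q ^ n)%C by ring. rewrite Cmod_pow.
    rewrite Rabs_right in HN; [easy|]. apply Rle_ge, pow_le, Cmod_ge_0.
Qed.

Lemma mobius_power_series (al : R) : 0 < al < 1 -> power_series_disc (mobius_coef al) (mobius al).
Proof.
  intros Hal z Hz. unfold in_disc in Hz. apply is_pseries_Ctends, Ctends_unshift.
  assert (Nz := mobius_denom_neq_0 al z Hal ltac:(lra)).
  assert (Hq : Cmod (al * z) < 1).
  { rewrite Cmod_mult, Cmod_RtoC_pos by lra. assert (0 <= Cmod z) by apply Cmod_ge_0. nra. }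
  (* The 0 stands for the limit of [(al z)^n]: with that power in its place, the expression is
     exactly the partial sum with [n + 1] terms. *)
  replace (mobius al z) with (mobius al z + (1 - al ^ 2) * z / (1 - al * z) * 0)%C by ring.
  eapply Ctends_ext; [|apply Ctends_plus; [apply Ctends_const|apply Ctends_scal, (Ctends_pow _ Hq)]].
  intros n. cbv beta. induction n as [|n IH].
  - simpl. unfold mobius. field. easy.
  - change (csum (fun i => mobius_coef al i * z ^ i)%C (S (S n))) with
      (csum (fun i => mobius_coef al i * z ^ i)%C (S n) + mobius_coef al (S n) * z ^ S n)%C.
    rewrite <- IH. unfold mobius_coef. rewrite RtoC_mult, RtoC_opp, RtoC_minus, !RtoC_pow.
    rewrite !Cpow_mult_l. simpl. field. easy.
Qed.

(** The remainder is an explicit fraction. The pole [1 / al] lies outside the closed unit disc, so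
    one constant serves the whole disc and the derivative is obtained at every point with
    [rho = 1]. *)
Lemma mobius_taylor (al : R) (z w : C) : 0 < al < 1 -> Cmod z <= 1 -> Cmod w <= 1 ->
  Cmod (mobius al w - mobius al z - - (1 - al ^ 2) / ((1 - al * z) * (1 - al * z)) * (w - z))
  <= 1 / ((1 - al) * ((1 - al) * (1 - al))) * Cmod (w - z) ^ 2.
Proof.
  intros Hal Hz Hw.
  assert (Dz := mobius_denom_ge al z Hal Hz). assert (Dw := mobius_denom_ge al w Hal Hw).
  assert (Nz := mobius_denom_neq_0 al z Hal Hz). assert (Nw := mobius_denom_neq_0 al w Hal Hw).
  replace (_ - _)%C with (RtoC (- ((1 - al ^ 2) * al)) * (w - z) ^ 2 / ((1 - al * w) * ((1 - al * z) * (1 - al * z))))%C.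
  - rewrite Cmod_div by (repeat apply Cmult_neq_0; easy).
    rewrite !Cmod_mult, Cmod_pow, Cmod_R, Rabs_Ropp, Rabs_right by nra.
    assert (0 < (1 - al) * ((1 - al) * (1 - al))) by (repeat apply Rmult_lt_0_compat; lra).
    assert ((1 - al) * ((1 - al) * (1 - al)) <=
      Cmod (1 - al * w) * (Cmod (1 - al * z) * Cmod (1 - al * z))).
    { apply Rmult_le_compat; try nra. }
    replace (1 / ((1 - al) * ((1 - al) * (1 - al))) * Cmod (w - z) ^ 2) with
      (Cmod (w - z) ^ 2 * / ((1 - al) * ((1 - al) * (1 - al)))) by (field; lra).
    assert (P := pow2_ge_0 (Cmod (w - z))).
    apply Rmult_le_compat.
    + apply Rmult_le_pos; nra.
    + left. apply Rinv_0_lt_compat. lra.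
    + rewrite <- (Rmult_1_l (Cmod (w - z) ^ 2)) at 2. apply Rmult_le_compat_r; [easy|].
      assert (0 <= al ^ 2 * al) by nra. nra.
    + now apply Rinv_le_contravar.
  - unfold mobius. rewrite RtoC_opp, RtoC_mult, RtoC_minus, RtoC_pow. field. easy.
Qed.

Lemma mobius_is_derive (al k : R) (z : C) : 0 < al < 1 -> in_disc z ->
  @is_derive C_AbsRing C_NormedModule (fun w => k * (mobius al w - al))%C z
    (k * (- (1 - al ^ 2) / ((1 - al * z) * (1 - al * z))))%C.
Proof.
  intros Hal Hz. unfold in_disc in Hz.
  apply is_derive_of_taylor with 1 (Rabs k * (1 / ((1 - al) * ((1 - al) * (1 - al))))); [easy|].
  intros w Hw.
  match goal with |- Cmod ?x <= _ => replace x with (k * (mobius al w - mobius al z -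
    - (1 - al ^ 2) / ((1 - al * z) * (1 - al * z)) * (w - z)))%C end.
  - rewrite Cmod_mult, Cmod_R, Rmult_assoc. apply Rmult_le_compat_l; [apply Rabs_pos|].
    apply mobius_taylor; lra.
  - unfold Cdiv. ring.
Qed.

Lemma rpow_1 (p : R) : rpow 1 p = 1.
Proof.
  unfold rpow. destruct (Rle_dec 1 0); [lra|]. unfold Rpower. now rewrite ln_1, Rmult_0_r, exp_0.
Qed.

Definition dilated_mobius_coef (al k : R) (n : nat) : C :=
  match n with O => RtoC 0 | S m => (k * mobius_coef al (S m))%C end.

(** Here [g' / h'] is the constant [(K - 1) / (K + 1)], the largest value allowed, and [||h|| = 1]
    meets the norm condition for every [p]. *)
Lemma mobius_admissible (al K p : R) : 0 < al < 1 -> 1 <= K ->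
  let g := (fun z => RtoC ((K - 1) / (K + 1)) * (mobius al z - al))%C in
  admissible K p (fun z => mobius al z + Cconj (g z))%C (mobius al) g
    (mobius_coef al) (dilated_mobius_coef al ((K - 1) / (K + 1))).
Proof.
  intros Hal HK. set (k := (K - 1) / (K + 1)). intros g.
  assert (Hk : 0 <= k < 1).
  { split; [apply Rdiv_le_0_compat; lra|]. apply Rmult_lt_reg_r with (K + 1); [lra|].
    unfold k, Rdiv. rewrite Rmult_assoc, Rinv_l; lra. }
  assert (Dg : forall z, in_disc z -> C_derive g z = (k * (- (1 - al ^ 2) / ((1 - al * z) * (1 - al * z))))%C).
  { intros z Hz. now apply is_C_derive_unique, mobius_is_derive. }
  assert (Dh' : forall z, in_disc z -> @is_derive C_AbsRing C_NormedModule (mobius al) z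
      (- (1 - al ^ 2) / ((1 - al * z) * (1 - al * z)))%C).
  { intros z Hz. unfold in_disc in Hz.
    eapply is_derive_of_taylor; [exact Hz|]. intros w Hw. apply mobius_taylor; lra. }
  assert (Dh : forall z, in_disc z -> C_derive (mobius al) z = (- (1 - al ^ 2) / ((1 - al * z) * (1 - al * z)))%C).
  { intros z Hz. now apply is_C_derive_unique, Dh'. }
  assert (Nh : forall z, in_disc z -> (- (1 - al ^ 2) / ((1 - al * z) * (1 - al * z)))%C <> 0).
  { intros z Hz. unfold in_disc in Hz. assert (N := mobius_denom_neq_0 al z Hal ltac:(lra)).
    apply Cmod_gt_0. rewrite Cmod_div by (now apply Cmult_neq_0).
    apply Rdiv_lt_0_compat; apply Cmod_gt_0; [|now apply Cmult_neq_0].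
    replace (- (1 - al ^ 2))%C with (RtoC (- (1 - al ^ 2))) by (rewrite RtoC_opp, RtoC_minus, RtoC_pow; reflexivity).
    intros E. apply RtoC_inj in E. nra. }
  assert (Hps := mobius_power_series al Hal).
  repeat split.
  - intros z Hz. eexists. now apply Dh'.
  - intros z Hz. eexists. now apply mobius_is_derive.
  - exact Hps.
  - intros z Hz. specialize (Hps z Hz). apply is_pseries_Ctends. apply is_pseries_Ctends in Hps.
    apply Ctends_unshift. apply Ctends_shift in Hps.
    unfold g. eapply Ctends_ext;
      [|apply Ctends_scal, Ctends_minus; [exact Hps|apply Ctends_const]].
    intros n. cbv beta. rewrite !csum_succ_l.
    rewrite (csum_ext (fun i => dilated_mobius_coef al k (S i) * z ^ S i)%C
      (fun i => k * (mobius_coef al (S i) * z ^ S i))%C) by (intros; simpl; ring).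
    rewrite csum_scal. simpl. ring.
  - intros z Hz. rewrite Dh, Dg by easy. rewrite Cmod_mult, Cmod_RtoC_pos by lra.
    specialize (Nh z Hz). apply Cmod_gt_0 in Nh.
    set (e := Cmod _) in *. rewrite Rpow_mult_distr.
    assert (0 < e ^ 2) by (apply pow_lt; easy). assert (k ^ 2 < 1) by nra. nra.
  - intros z Hz. rewrite Dh, Dg by easy. specialize (Nh z Hz).
    set (e := (_ / _)%C) in *. replace (k * e / e)%C with (RtoC k) by (field; easy).
    rewrite Cmod_RtoC_pos by lra. apply Rle_refl.
  - exists 1. intros z Hz. now apply Cmod_mobius_le.
  - rewrite (sup_norm_mobius al Hal), rpow_1. lra.
Qed.

(** Both [1 - al^p] and the coefficients of [h] are of order [1 - al]; this factor is cancelled, and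
    as [al] tends to 1 the conclusion becomes [2 (1 + k) (F(r) - 1) <= p], which is the root
    equation as an inequality. In [HU] a factor [1 / al] is given away, which is harmless in that
    limit. *)
Lemma bohr_inequality_mobius (gam : nat -> R) (p k al r : R) :
  (forall n, 0 <= gam n <= 1) -> 0 < al < 1 -> 0 <= k -> 0 < p -> 0 <= r < 1 ->
  bohr_inequality gam p (mobius al) (mobius_coef al) (dilated_mobius_coef al k) r ->
  al * (1 + al) * ((1 + k) * tail_series gam (al * r)) <= p.
Proof.
  intros Hg Hal Hk Hp Hr (Eu & Ev & H). rewrite (sup_norm_mobius al Hal) in H.
  set (W := tail_series gam (al * r)).
  set (u := fun n => gam (S n) * Cmod (mobius_coef al (S n)) * r ^ S n) in *.
  assert (Ec : forall n, Cmod (mobius_coef al (S n)) = (1 - al ^ 2) * al ^ n).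
  { intros n. simpl mobius_coef. assert (0 <= al ^ n) by (apply pow_le; lra).
    rewrite Cmod_R, Rabs_mult, Rabs_Ropp, !Rabs_right; nra. }
  assert (HV : Series (fun n => gam (S n) * Cmod (dilated_mobius_coef al k (S n)) * r ^ S n) = k * Series u).
  { rewrite <- Series_scal_l. apply Series_ext. intros n. unfold u, dilated_mobius_coef.
    rewrite Cmod_mult, Cmod_RtoC_pos by lra. ring. }
  rewrite HV in H.
  assert (HU : (1 - al ^ 2) * W <= Series u).
  { unfold W, tail_series. rewrite <- Series_scal_l. apply Series_le; [|exact Eu].
    intros n. unfold u. rewrite Ec. specialize (Hg (S n)).
    assert (P1 : 0 <= al ^ n) by (apply pow_le; lra). assert (P2 : 0 <= r ^ S n) by (apply pow_le; lra).
    assert (P3 : 0 <= 1 - al ^ 2) by nra.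
    rewrite Rpow_mult_distr, <- (tech_pow_Rmult al n). split.
    - apply Rmult_le_pos; [lra|]. apply Rmult_le_pos; [lra|].
      apply Rmult_le_pos; [apply Rmult_le_pos; lra|easy].
    - assert (P4 : 0 <= gam (S n) * (1 - al ^ 2) * al ^ n * r ^ S n)
        by (apply Rmult_le_pos; [apply Rmult_le_pos; [apply Rmult_le_pos|]|]; lra).
      nra. }
  simpl mobius_coef in H. rewrite Cmod_RtoC_pos in H by lra.
  (* Two uses of [exp t >= 1 + t]: [al^p >= 1 + p ln al], and [- ln al <= 1 / al - 1]. *)
  assert (HP : 1 - p * ((1 - al) / al) <= rpow al p).
  { unfold rpow. destruct (Rle_dec al 0); [lra|]. unfold Rpower.
    eapply Rle_trans; [|apply exp_ineq1_le].
    assert (E := exp_ineq1_le (- ln al)). rewrite exp_Ropp, exp_ln in E by lra.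
    assert (- ln al <= (1 - al) / al) by (replace ((1 - al) / al) with (/ al - 1) by (field; lra); lra).
    nra. }
  assert (H1 : (1 + k) * ((1 - al ^ 2) * W) <= p * ((1 - al) / al)).
  { apply Rle_trans with ((1 + k) * Series u); [apply Rmult_le_compat_l; lra|]. lra. }
  apply Rmult_le_reg_r with ((1 - al) / al); [apply Rdiv_lt_0_compat; lra|].
  replace (al * (1 + al) * ((1 + k) * W) * ((1 - al) / al)) with ((1 + k) * ((1 - al ^ 2) * W))
    by (field; lra).
  exact H1.
Qed.

Theorem theorem3p2 (K p a b c r0 : R)
    (hK : 1 <= K) (hp : 0 < p <= 2)
    (ha : 0 < a) (hb : 0 < b) (hc : 0 < c)
    (habc : forall (n : nat) (r : R), 0 <= r <= 1 ->
       (a + INR n) * (b + INR n) * r - (c + INR n) * (1 + INR n) <= 0)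
    (hr0 : minimal_positive_root (fun r => hyp2F1 a b c r - 1)
             (p * (K + 1) / (4 * K)) r0) :
  (forall (f h g : C -> C) (an bn : nat -> C),
     admissible K p f h g an bn ->
     forall r : R, 0 <= r <= r0 ->
       bohr_inequality (hyp_coef a b c) p h an bn r)
  /\
  (forall r0' : R, r0 < r0' ->
     ~ (forall (f h g : C -> C) (an bn : nat -> C),
          admissible K p f h g an bn ->
          forall r : R, 0 <= r <= r0' -> r < 1 ->
            bohr_inequality (hyp_coef a b c) p h an bn r)).
Proof.
  set (gam := hyp_coef a b c).
  assert (Mg : forall n, gam (S n) <= gam n).
  { intros n. apply hyp_coef_decr; try easy. specialize (habc n 1 ltac:(lra)). lra. }
  assert (Hg : forall n, 0 <= gam n <= 1).
  { intros n. split; [left; now apply hyp_coef_pos|].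
    induction n as [|n IH]; [unfold gam; rewrite hyp_coef_0; lra|].
    specialize (Mg n). lra. }
  destruct hr0 as (Hr0 & E0 & _). rewrite hyp2F1_tail in E0 by (easy || lra). fold gam in E0.
  split.
  - intros f h g an bn Hadm r Hr.
    apply bohr_inequality_holds with K f g; try easy; [lra|].
    rewrite <- E0. apply tail_series_le; [easy|lra|lra].
  - intros r0' Hr0' Hall.
    set (k := (K - 1) / (K + 1)).
    assert (Hk : 0 <= k) by (apply Rdiv_le_0_compat; lra).
    (* [r] is an admissible radius beyond [r0]. The auxiliary [r1] between [r0] and [r] leaves room
       for the factor [al] in [tail_series gam (al * r)]: for [al] near 1 still [r1 <= al * r]. *)
    set (r := (r0 + Rmin r0' 1) / 2).
    assert (M1 := Rmin_l r0' 1). assert (M2 := Rmin_r r0' 1).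
    assert (M3 : r0 < Rmin r0' 1) by (apply Rmin_glb_lt; lra).
    set (r1 := (r0 + r) / 2).
    assert (Hr : r0 < r < 1 /\ r <= r0') by (unfold r; lra).
    assert (Hr1 : r0 < r1 < r) by (unfold r1; lra).
    assert (PW0 : 0 < tail_series gam r0).
    { rewrite E0. apply Rdiv_lt_0_compat; [apply Rmult_lt_0_compat|]; lra. }
    assert (HW := tail_series_lt gam r0 r1 Hg ltac:(lra) ltac:(lra) PW0).
    set (q := (1 + k) * tail_series gam r1).
    assert (Hq : p < 2 * q).
    { apply Rle_lt_trans with (2 * ((1 + k) * tail_series gam r0)).
      - rewrite E0. right. unfold k. field. lra.
      - unfold q. apply Rmult_lt_compat_l; [lra|]. apply Rmult_lt_compat_l; lra. }
    (* With [al = 1 - e], the entries ensure [al > 0], [r1 <= al * r], and [3 e q <= (2 q - p) / 2].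
       Since [al (1 + al) = 2 - 3 e + e^2], the inequality [al (1 + al) q <= p] would give
       [2 q - p <= 3 e q], at most half of the positive number [2 q - p]. *)
    set (e := Rmin (1 / 2) (Rmin (1 - r1 / r) ((2 * q - p) / (6 * q)))).
    assert (Hrr : 0 < 1 - r1 / r).
    { assert (r1 / r < 1); [|lra]. apply Rmult_lt_reg_r with r; [lra|].
      unfold Rdiv. rewrite Rmult_assoc, Rinv_l; lra. }
    assert (He : 0 < e).
    { repeat apply Rmin_pos; try lra. apply Rdiv_lt_0_compat; lra. }
    assert (He1 : e <= 1 / 2) by apply Rmin_l.
    assert (He2 : e <= 1 - r1 / r) by (eapply Rle_trans; [apply Rmin_r|apply Rmin_l]).
    assert (He3 : e <= (2 * q - p) / (6 * q)) by (eapply Rle_trans; [apply Rmin_r|apply Rmin_r]).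
    assert (Hal : 0 < 1 - e < 1) by lra.
    assert (HB := Hall _ _ _ _ _ (mobius_admissible (1 - e) K p Hal hK) r ltac:(lra) ltac:(lra)).
    apply bohr_inequality_mobius in HB; try easy; try lra. fold k in HB.
    assert (Hr1r : r1 <= (1 - e) * r).
    { apply Rle_trans with (r1 / r * r); [right; field; lra|]. apply Rmult_le_compat_r; lra. }
    assert (HWW : tail_series gam r1 <= tail_series gam ((1 - e) * r)).
    { apply tail_series_le; [easy|lra|nra]. }
    assert (HB' : (1 - e) * (1 + (1 - e)) * q <= p).
    { eapply Rle_trans; [|exact HB]. apply Rmult_le_compat_l; [nra|].
      unfold q. apply Rmult_le_compat_l; lra. }
    apply Rmult_le_compat_r with (r := 6 * q) in He3; [|lra].
    replace ((2 * q - p) / (6 * q) * (6 * q)) with (2 * q - p) in He3 by (field; lra).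
    assert (0 <= e * e * q) by (repeat apply Rmult_le_pos; lra).
    lra.
Qed.
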